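(* Let $1<p<\infty$ and $1/p+1/q=1$. A complex sequence $(b_n)_{n=1}^\infty$ satisfies that for every $\sum_{n=1}^\infty a_nn^{-s}\in\mathcal{H}(ces_p)$ the series $\sum_{n=1}^\infty a_nb_nn^{-s}$ is a multiplier on $\mathcal{H}(ces_p)$ if and only if $$\big(b_nn^{-1/q}\big)_{n=1}^\infty\in d(q),$$ that is, the following condition holds: $$\sum_{n=1}^\infty\sup_{k\ge n}\Big(\frac{|b_k|^q}{k}\Big)<\infty.$$
   Context: For $\theta\in\mathbb{R}$, $\mathbb{C}_\theta:=\{s\in\mathbb{C}:\Re(s)>\theta\}$. For $1<p<\infty$, the Ces\`aro sequence space $ces_p$ consists of all complex sequences $(a_n)_{n=1}^\infty$ with $$\|(a_n)_{n=1}^\infty\|_{ces_p}:=\Big(\sum_{n=1}^\infty\Big(\frac1n\sum_{k=1}^n|a_k|\Big)^p\Big)^{1/p}<\infty.$$ $\mathcal{H}(ces_p)$ is the Banach space of all Dirichlet series $f(s)=\sum_{n=1}^\infty a_nn^{-s}$ with $(a_n)_{n=1}^\infty\in ces_p$, with norm $\|f\|_{\mathcal{H}(ces_p)}:=\|(a_n)_{n=1}^\infty\|_{ces_p}$. Every such $f$ converges absolutely, hence is analytic, on $\mathbb{C}_{1/q}$. A multiplier on $\mathcal{H}(ces_p)$ is an analytic function $f$ on $\mathbb{C}_{1/q}$ such that $fg\in\mathcal{H}(ces_p)$ for every $g\in\mathcal{H}(ces_p)$ (pointwise product; in terms of coefficients it is the Dirichlet convolution $(a\cdot b)_n=\sum_{k|n}a_kb_{n/k}$).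 The space $d(q)$ consists of all complex sequences $(c_n)_{n=1}^\infty$ with $\|(c_n)_{n=1}^\infty\|_{d(q)}:=\big(\sum_{n=1}^\infty\sup_{k\ge n}|c_k|^q\big)^{1/q}<\infty$; by a result of Bennett it is (isomorphically) the dual space of $ces_p$ under the pairing $\sum_{n=1}^\infty a_nc_n$. *)

(* Defs.v *)
From mathcomp Require Import all_boot all_order all_algebra.
From mathcomp Require Import all_classical all_reals all_analysis.
From mathcomp Require Import complex.

Set Implicit Arguments.
Unset Strict Implicit.
Unset Printing Implicit Defensive.

Import Order.TTheory GRing.Theory Num.Theory.
Import numFieldNormedType.Exports.
Import Normc.

Local Open Scope classical_set_scope.
Local Open Scope ring_scope.
Local Open Scope complex_scope.

(* A sequence (a_n)_{n >= 1} is encoded as a function on nat whose value at 0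
   is never used: all the sums and suprema below range over n >= 1.           *)

Section SequenceSpaces.
Variable R : realType.
Implicit Types (p q : R) (a c : nat -> R[i]).

Definition ces_norm p a : \bar R :=
  poweR (\sum_(1 <= n <oo)
          ((n%:R^-1 * \sum_(1 <= k < n.+1) normc (a k)) `^ p)%:E)%E p^-1.

Definition ces p : set (nat -> R[i]) := [set a | (ces_norm p a < +oo)%E].

Definition d_norm q c : \bar R :=
  poweR (\sum_(1 <= n <oo)
          ereal_sup [set (normc (c k) `^ q)%:E | k in [set k | (n <= k)%N]])%E
        q^-1.

Definition d_space q : set (nat -> R[i]) := [set c | (d_norm q c < +oo)%E].

End SequenceSpaces.

Section DirichletSeries.
Variable R : realType.
Implicit Types (p q : R) (a : nat -> R[i]) (s : R[i]) (f g : R[i] -> R[i]).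

(* n^s = exp (s ln n), for n >= 1 *)
Definition natpowC (n : nat) s : R[i] :=
  (n%:R `^ complex.Re s)%:C *
  (cos (complex.Im s * ln n%:R) +i* sin (complex.Im s * ln n%:R)).

Definition half_plane (theta : R) : set R[i] :=
  [set s | theta < complex.Re s].

Definition dirichlet_partial_sum a s (n : nat) : R[i] :=
  \sum_(1 <= k < n.+1) a k * natpowC k (- s).

(* The topology of the complex plane is carried by the regular module R[i]^o,
   whence the casts here and in [analytic_on].                                *)
Definition dirichlet_sum_on (D : set R[i]) a f : Prop :=
  forall s, D s ->
    (dirichlet_partial_sum a s : nat -> R[i]^o) @ \oo --> (f s : R[i]^o).

(* Complex differentiability; to be used with an open set D. *)
Definition analytic_on (D : set R[i]) f : Prop :=
  forall s, D s -> derivable (f : R[i]^o -> R[i]^o) s 1.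

(* Functions are total; only their values on the half-plane Re s > 1/q, with q
   the conjugate exponent of p, are relevant in the next two definitions.     *)
Definition H_ces p q : set (R[i] -> R[i]) :=
  [set g | exists2 a, ces p a & dirichlet_sum_on (half_plane q^-1) a g].

Definition multiplier p q f : Prop :=
  analytic_on (half_plane q^-1) f /\
  forall g, H_ces p q g -> H_ces p q (fun s => f s * g s).

(* The Dirichlet series with coefficients a is a multiplier: it converges on
   the half-plane, to a function which is a multiplier.                       *)
Definition dirichlet_multiplier p q a : Prop :=
  exists2 f, dirichlet_sum_on (half_plane q^-1) a f & multiplier p q f.

End DirichletSeries.

(* Main.v *)
Require Import Defs.
From mathcomp Require Import all_boot all_order all_algebra.
From mathcomp Require Import all_classical all_reals all_analysis.
From mathcomp Require Import complex ring lra.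

Import Order.TTheory GRing.Theory Num.Theory.
Import numFieldNormedType.Exports.
Import Normc.

Local Open Scope classical_set_scope.
Local Open Scope ring_scope.
Local Open Scope complex_scope.

Set Implicit Arguments.
Unset Strict Implicit.
Unset Printing Implicit Defensive.

(* Write [c k = |b k| k^(-1/q)], and measure a sequence of ces_p by its Cesaro
   averages.

   Sufficiency.  If [c] lies in d(q), the duality of d(q) and ces_p gives
   [\sum_k |a k b k| k^(-1/q) < +oo] for [a] in ces_p.  Dilation by [k] has norm
   at most [k^(-1/q)] on ces_p, so Dirichlet convolution by [a b] preserves
   ces_p, and Mertens' theorem identifies it with the product of functions.

   Necessity.  After a change of phases, uniqueness of Dirichlet coefficients
   shows that [(a |b|) * g] is in ces_p for all nonnegative [a], [g] in ces_p.
   The map [(a, g) -> (a |b|) * g] is monotone, so a gliding sum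
   [\sum_j 2^-j a_j] replaces the closed graph theorem and shows that it is
   bounded.  Testing on the [g] whose partial sums are [min(n, M)^(1/q)] and
   letting [M] go to infinity bounds [\sum_k a k c k] by the norm of [a].
   Finally, for a selection [kappa n >= n] approaching the suprema, test on
   [a = \sum_n c (kappa n)^(q-1) e_(kappa n)]: its partial sums are dominated by
   those of [c (kappa n)^(q-1)], so Hardy's inequality controls its norm. *)

(** * Sums and Dirichlet convolution *)

(** The target is any commutative monoid: the same sums serve complex coefficients and their real
    majorants. *)
Definition psum (V : nmodType) (u : nat -> V) (n : nat) : V :=
  \sum_(1 <= k < n.+1) u k.
Arguments psum {V} u n.

Definition dconv (A : pzSemiRingType) (u v : nat -> A) (n : nat) : A :=
  \sum_(1 <= k < n.+1 | (k %| n)%N) u k * v (n %/ k)%N.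
Arguments dconv {A} u v n.

Lemma psum0 (V : nmodType) (u : nat -> V) : psum u 0 = 0.
Proof. by rewrite /psum big_geq. Qed.

Lemma psumS (V : nmodType) (u : nat -> V) (n : nat) :
  psum u n.+1 = psum u n + u n.+1.
Proof. by rewrite /psum big_nat_recr. Qed.

Lemma eq_psum (V : nmodType) (u v : nat -> V) (n : nat) :
  (forall k, (0 < k <= n)%N -> u k = v k) -> psum u n = psum v n.
Proof. by move=> uv; apply: eq_big_nat => k /uv. Qed.

Lemma psumD (V : nmodType) (u v : nat -> V) (n : nat) :
  psum (fun k => u k + v k) n = psum u n + psum v n.
Proof. exact: big_split. Qed.

Lemma psumZl (A : pzSemiRingType) (x : A) (u : nat -> A) (n : nat) :
  psum (fun k => x * u k) n = x * psum u n.
Proof. by rewrite /psum mulr_sumr. Qed.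

Lemma psumZr (A : pzSemiRingType) (x : A) (u : nat -> A) (n : nat) :
  psum (fun k => u k * x) n = psum u n * x.
Proof. by rewrite /psum mulr_suml. Qed.

(** In the induction, the quotient by [k] increases from [n] to [n.+1] exactly when [k] divides
    [n.+1]. *)
Lemma psum_div (V : nmodType) (w : nat -> V) (k n : nat) : (0 < k)%N ->
  \sum_(1 <= m < n.+1 | (k %| m)%N) w (m %/ k)%N = psum w (n %/ k).
Proof.
move=> k0; elim: n => [|n IH]; first by rewrite div0n psum0 big_geq.
rewrite big_mkcond big_nat_recr//= -big_mkcond IH.
by rewrite divnS//; case: (k %| n.+1)%N; rewrite ?addr0// psumS.
Qed.

(** Exchange of summation. In this form [v] enters only through dilated partial sums; the norm
    estimates and Mertens' theorem below start from it. *)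
Lemma psum_dconv (A : pzSemiRingType) (u v : nat -> A) (n : nat) :
  psum (dconv u v) n = psum (fun k => u k * psum v (n %/ k)) n.
Proof.
transitivity (\sum_(1 <= m < n.+1) \sum_(1 <= k < n.+1 | (k %| m)%N)
    u k * v (m %/ k)%N).
  apply: eq_big_nat => m /andP[m1 mn]; rewrite /dconv.
  rewrite (big_nat_widen _ m.+1 n.+1)//; apply: eq_bigl => k.
  by case: (boolP (k %| m)%N) => //= km; rewrite ltnS dvdn_leq.
rewrite (exchange_big_dep_nat predT)//=.
apply: eq_big_nat => k /andP[k0 _].
by rewrite -psum_div// mulr_sumr; apply: eq_bigr.
Qed.

Section RealPsum.
Variable R : realType.
Implicit Types (u v w : nat -> R).

Lemma psum_ge0 u n : (forall k, 0 <= u k) -> 0 <= psum u n.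
Proof. by move=> u0; rewrite /psum sumr_ge0. Qed.

Lemma ler_psum u v n : (forall k, (0 < k <= n)%N -> u k <= v k) ->
  psum u n <= psum v n.
Proof. by move=> uv; apply: ler_sum_nat => k /uv. Qed.

Lemma psum_homo u : (forall k, 0 <= u k) ->
  {homo psum u : m n / (m <= n)%N >-> m <= n}.
Proof.
move=> u0; apply: homo_leq => // [|n]; first exact: le_trans.
by rewrite psumS lerDl.
Qed.

Lemma ler_term_psum u n k : (forall k, 0 <= u k) -> (0 < k <= n)%N ->
  u k <= psum u n.
Proof.
case: k => // k u0 /= kn; apply: le_trans (psum_homo u0 kn).
by rewrite psumS lerDr psum_ge0.
Qed.

Lemma dconv_ge0 u v n : (forall k, 0 <= u k) -> (forall k, 0 <= v k) ->
  0 <= dconv u v n.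
Proof. by move=> u0 v0; apply: sumr_ge0 => k _; rewrite mulr_ge0. Qed.

Lemma ler_dconv u u' v v' n :
  (forall k, 0 <= u k <= u' k) -> (forall k, 0 <= v k <= v' k) ->
  dconv u v n <= dconv u' v' n.
Proof.
move=> uu vv; apply: ler_sum => k _.
by have /andP[? ?] := uu k; have /andP[? ?] := vv (n %/ k)%N; rewrite ler_pM.
Qed.

End RealPsum.

(** * Cesaro averages *)

Section Zeta.
Variable R : realType.
Implicit Types (p : R).

(** Condensation: the partial sums [S] satisfy [S n <= S (2n+1) <= 1 + 2^(1-p) S n] with
    [2^(1-p) < 1], which can be solved for [S n]. *)
Lemma zeta_bounded p : 1 < p ->
  exists2 Z : R, 0 < Z & forall n, psum (fun k => k%:R `^ (- p)) n <= Z.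
Proof.
move=> p1; set u := fun k : nat => (k%:R : R) `^ (- p).
have u0 k : 0 <= u k by exact: powR_ge0.
have u2 k : u k.*2 = 2 `^ (- p) * u k.
  by rewrite /u -mul2n natrM powRM.
have rec n : psum u n.*2.+1 <= 1 + 2 `^ (1 - p) * psum u n.
  elim: n => [|n IH].
    by rewrite psum0 mulr0 addr0 psumS psum0 add0r /u powR1.
  (* The odd term at [2n+3] is at most the even term at [2n+2], so the two new terms add at most
     [2 * u (2n+2)]. *)
  rewrite doubleS 2!(psumS u n.*2.+1, psumS u n.*2.+2) (psumS u n) mulrDr.
  rewrite addrA -[leLHS]addrA; apply: lerD => //.
  have -> : 2 `^ (1 - p) = 2 * 2 `^ (- p) :> R.
    by rewrite powRD ?powRr1 ?pnatr_eq0 ?implybT.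
  rewrite -mulrA -u2 mulr_natl mulr2n doubleS lerD2l /u !powRN.
  by rewrite lef_pV2 ?posrE ?powR_gt0// ge0_ler_powR ?nnegrE ?ler_nat//; lra.
have r1 : 2 `^ (1 - p) < 1 :> R.
  rewrite -[ltRHS](powRr0 2) /powR pnatr_eq0/= ltr_expR ltr_pM2r; first lra.
  by rewrite ln_gt0// ltr1n.
have r0 : 0 < 1 - 2 `^ (1 - p) :> R by lra.
exists (1 - 2 `^ (1 - p))^-1; first by rewrite invr_gt0.
move=> n; rewrite -div1r ler_pdivlMr// mulrBr mulr1 lerBlDr mulrC.
apply: le_trans (rec n); apply: psum_homo => //.
by rewrite -addnn -addnS leq_addr.
Qed.

End Zeta.

(** * Jensen, dilation, Hardy and duality inequalities for Cesaro averages *)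

Section CesaroSums.
Variables (R : realType) (p q : R).
Hypotheses (hp : 1 < p) (hpq : p^-1 + q^-1 = 1).
Implicit Types (a u v w x d : nat -> R).

Lemma conjugate_gt1 : 1 < q.
Proof.
have p0 : 0 < p := lt_trans ltr01 hp.
have pV0 : 0 < p^-1 by rewrite invr_gt0.
have pV1 : p^-1 < 1 by rewrite invf_lt1.
have qV1 : q^-1 < 1 by rewrite -hpq ltrDr.
have q0 : 0 < q by rewrite -invr_gt0 -(ltrD2l p^-1) hpq addr0.
by rewrite -invf_lt1.
Qed.

Let q1 : 1 < q := conjugate_gt1.
Let p0 : 0 < p := lt_trans ltr01 hp.
Let q0 : 0 < q := lt_trans ltr01 q1.
Let pN0 : p != 0. Proof. by rewrite gt_eqF. Qed.
Let qN0 : q != 0. Proof. by rewrite gt_eqF. Qed.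

Lemma conjugateM : p * q = p + q.
Proof.
have : p * q * (p^-1 + q^-1) = p * q by rewrite hpq mulr1.
by rewrite mulrDr mulrAC divff// mul1r mulfK// addrC => ->.
Qed.

Lemma conjugateB1 : (p - 1) * q = p.
Proof. by rewrite mulrBl mul1r conjugateM addrK. Qed.

Lemma conjugate_div : p / q = p - 1.
Proof. by apply: (mulIf qN0); rewrite divfK// conjugateB1. Qed.

Lemma powRB1_conj (y : R) : (y `^ (p - 1)) `^ q = y `^ p.
Proof. by rewrite -powRrM conjugateB1. Qed.

Lemma powRV_conj (y : R) : (y `^ q^-1) `^ p = y `^ (p - 1).
Proof. by rewrite -powRrM mulrC conjugate_div. Qed.

(** Young's inequality [x k * Y^(p-1) <= x k^p / p + Y^p / q] is summed against the weights at
    [Y = X / W]. As [W * Y = X], the second term is the fraction [1/q] of the left side and is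
    absorbed. The total weight need only be at most [W]. *)
Lemma powR_jensen (n : nat) (w x : nat -> R) (W : R) :
  0 < W -> (forall k, 0 <= w k) -> (forall k, 0 <= x k) -> psum w n <= W ->
  (psum (fun k => w k * x k) n) `^ p
    <= W `^ (p - 1) * psum (fun k => w k * x k `^ p) n.
Proof.
move=> W0 w0 x0 wW; set X := psum (fun k => w k * x k) n.
set T := psum _ n.
have X0 : 0 <= X by apply: psum_ge0 => k; rewrite mulr_ge0.
have [Y Y0 WY] : exists2 Y, 0 <= Y & W * Y = X.
  exists (X / W); first by rewrite divr_ge0// ltW.
  by rewrite mulrC divfK// gt_eqF.
have : X * Y `^ (p - 1) <= T / p + W * (Y `^ p / q).
  apply: (@le_trans _ _ (T / p + psum w n * (Y `^ p / q))); last first.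
    by rewrite lerD2l ler_wpM2r// divr_ge0 ?powR_ge0// ltW.
  rewrite -!psumZr -psumD; apply: ler_psum => k _.
  rewrite -!mulrA -mulrDr ler_wpM2l//.
  by rewrite -(powRB1_conj Y) conjugate_powR// powR_ge0.
have -> : Y `^ p = Y * Y `^ (p - 1) by rewrite mulr_powRB1.
have -> : W * (Y * Y `^ (p - 1) / q) = X * Y `^ (p - 1) / q.
  by rewrite !mulrA WY.
move=> h.
have {}h : X * Y `^ (p - 1) / p <= T / p.
  have e : X * Y `^ (p - 1) = X * Y `^ (p - 1) / p + X * Y `^ (p - 1) / q.
    by rewrite -mulrDr hpq mulr1.
  by move: h; rewrite {1}e lerD2r.
move: h; rewrite ler_pM2r ?invr_gt0// => h.
apply: le_trans (ler_wpM2l (powR_ge0 _ _) h).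
rewrite mulrCA -powRM ?(ltW W0)// WY.
by rewrite mulr_powRB1.
Qed.

Definition ces_avg a n : R := n%:R^-1 * psum a n.

(** [B] bounds the [p]-th power of the norm, not the norm; finite sums replace the infinite series
    and its root. *)
Definition ces_bounded a (B : R) : Prop :=
  forall n, psum (fun k => ces_avg a k `^ p) n <= B.

Lemma ces_avg_ge0 a n : (forall k, 0 <= a k) -> 0 <= ces_avg a n.
Proof. by move=> a0; rewrite mulr_ge0 ?invr_ge0 ?psum_ge0. Qed.

Lemma ler_ces_avg a u n : (forall k, 0 <= a k <= u k) ->
  ces_avg a n <= ces_avg u n.
Proof.
move=> au; rewrite ler_wpM2l ?invr_ge0// ler_psum// => k _.
by have /andP[] := au k.
Qed.

Lemma ces_avgZ (c : R) a n : ces_avg (fun k => c * a k) n = c * ces_avg a n.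
Proof. by rewrite /ces_avg psumZl mulrCA. Qed.

Lemma ler_psum_ces a u n : (forall k, 0 <= a k <= u k) ->
  psum (fun k => ces_avg a k `^ p) n <= psum (fun k => ces_avg u k `^ p) n.
Proof.
move=> au; apply: ler_psum => k _.
have a0 j : 0 <= a j by have /andP[] := au j.
have u0 j : 0 <= u j by have /andP[/le_trans h /h] := au j.
by rewrite ge0_ler_powR ?nnegrE ?ces_avg_ge0 ?ler_ces_avg// ltW.
Qed.

Lemma ces_bounded_ge0 a (B : R) : ces_bounded a B -> 0 <= B.
Proof. by move=> /(_ 0%N); rewrite psum0. Qed.

(** Dilation by [k] has norm at most [k^(-1/q)]: the [k] indices [m] with quotient [j] each
    contribute at most [(ces_avg a j / k)^p], so a block contributes [k^(1-p)] times the [j]-th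
    term. *)
Lemma psum_ces_shift a (n k : nat) (B : R) : (0 < k)%N ->
  ces_bounded a B -> (forall j, 0 <= a j) ->
  psum (fun m => (m%:R^-1 * psum a (m %/ k)) `^ p) n <= k%:R `^ (1 - p) * B.
Proof.
move=> k0 aB a0; set F := fun m : nat => _.
have F0 m : 0 <= F m by exact: powR_ge0.
have kR : 0 < k%:R :> R by rewrite ltr0n.
(* The range is enlarged to whole blocks of length [k]; the block of quotient 0 vanishes. *)
apply: (@le_trans _ _ (\sum_(0 <= m < n.+1 * k) F m)).
  apply: (@le_trans _ _ (\sum_(0 <= m < n.+1) F m)).
    by rewrite [leRHS]big_ltn// lerDr.
  rewrite [leRHS](@big_cat_nat _ _ _ n.+1)//=; last by rewrite leq_pmulr.
  by rewrite lerDl sumr_ge0.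
rewrite big_nat_mul big_ltn//= big1_seq ?add0r; last first.
  move=> m; rewrite mem_index_iota mul0n mul1n => /andP[_ mk].
  by rewrite /F divn_small// psum0 mulr0 powR0.
apply: le_trans (ler_wpM2l (powR_ge0 _ _) (aB n)).
rewrite -psumZl; apply: ler_sum_nat => j /andP[j0 jn].
apply: (@le_trans _ _ (\sum_(j * k <= i < j.+1 * k)
    (k%:R^-1 * ces_avg a j) `^ p)).
  apply: ler_sum_nat => m /andP[jm mj].
  have mjk : (m %/ k = j)%N.
    by apply/eqP; rewrite eqn_leq -ltnS ltn_divLR// mj leq_divRL.
  have jR : 0 < j%:R :> R by rewrite ltr0n.
  rewrite /F mjk ge0_ler_powR ?nnegrE ?(ltW p0) ?mulr_ge0 ?invr_ge0
    ?ces_avg_ge0 ?psum_ge0//.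
  rewrite mulrA ler_wpM2r ?psum_ge0// -invfM -natrM mulnC lef_pV2 ?posrE ?ltr0n.
  - by rewrite ler_nat.
  - by rewrite (leq_trans _ jm)// muln_gt0 j0.
  - by rewrite muln_gt0 j0.
rewrite sumr_const_nat -mulnBl subSnn mul1n powRM ?invr_ge0 ?ces_avg_ge0//.
rewrite -mulrnAl ler_wpM2r ?powR_ge0// -[leLHS]mulr_natl.
rewrite powRD ?(gt_eqF kR) ?implybT// powRr1 ?ler0n//.
by rewrite -powR_inv1 ?ler0n// -powRrM mulN1r.
Qed.

(** Jensen's inequality plays the part of Minkowski's. The factor [k^(1/q)] is moved from the weight
    into [x], where its [p]-th power [k^(p-1)] cancels the [k^(1-p)] of the dilation bound. *)
Lemma ces_bounded_dconv c a (W B : R) :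
  0 < W -> (forall k, 0 <= c k) -> (forall k, 0 <= a k) ->
  (forall n, psum (fun k => c k * k%:R `^ (- q^-1)) n <= W) ->
  ces_bounded a B -> ces_bounded (dconv c a) (W `^ p * B).
Proof.
move=> W0 c0 a0 cW aB n.
pose w k := c k * k%:R `^ (- q^-1).
pose x m k := k%:R `^ q^-1 * (m%:R^-1 * psum a (m %/ k)).
have w0 k : 0 <= w k by rewrite mulr_ge0 ?powR_ge0.
have x0 m k : 0 <= x m k by rewrite !mulr_ge0 ?powR_ge0 ?invr_ge0 ?psum_ge0.
(* Terms with [k > m] vanish because [m %/ k = 0]; a range independent of [m] allows the sums over
   [k] and [m] to be exchanged. *)
have avgE m : (m <= n)%N ->
    ces_avg (dconv c a) m = psum (fun k => w k * x m k) n.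
  move=> mn; rewrite /ces_avg psum_dconv -psumZl.
  rewrite [RHS]/psum (@big_cat_nat _ _ _ m.+1)//= [X in _ + X]big1_seq ?addr0.
    apply: eq_psum => k /andP[k0 _]; rewrite /w /x powRN mulrA -[in RHS]mulrA.
    rewrite mulKf; last by rewrite gt_eqF// powR_gt0// ltr0n.
    by rewrite mulrCA mulrA.
  move=> k; rewrite mem_index_iota => /andP[_ /andP[mk _]].
  by rewrite /x divn_small// psum0 !mulr0.
apply: (@le_trans _ _ (psum (fun m =>
    W `^ (p - 1) * psum (fun k => w k * x m k `^ p) n) n)).
  by apply: ler_psum => m /andP[_ mn]; rewrite avgE// powR_jensen.
rewrite psumZl -(mulr_powRB1 (ltW W0) p0) mulrAC [leRHS]mulrC.
rewrite ler_wpM2l ?powR_ge0// [X in X <= _]exchange_big/=.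
apply: (@le_trans _ _ (psum (fun k => w k * B) n)); last first.
  by rewrite psumZr ler_wpM2r ?cW// (ces_bounded_ge0 aB).
apply: ler_psum => k /andP[k0 _].
rewrite -mulr_sumr ler_wpM2l//.
have := psum_ces_shift n k0 aB a0.
move=> /(ler_wpM2l (powR_ge0 k%:R (p - 1))).
rewrite mulrA -powRD ?pnatr_eq0 -?lt0n ?k0 ?implybT//.
have -> : p - 1 + (1 - p) = 0 by ring.
rewrite powRr0 mul1r -psumZl.
apply: le_trans; apply: ler_psum => m _.
by rewrite /x powRM ?powR_ge0 ?mulr_ge0 ?invr_ge0 ?psum_ge0// powRV_conj.
Qed.

(* Elliott's argument: Young's inequality applied to
   [a n = n A_n - (n-1) A_(n-1)], where [A] is the sequence of averages of [a],
   makes the sum telescope. *)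
Lemma psum_ces_avg_powR a n : (forall k, 0 <= a k) ->
  psum (fun k => ces_avg a k `^ p) n
    <= q * psum (fun k => ces_avg a k `^ (p - 1) * a k) n.
Proof.
move=> a0; pose A := ces_avg a; have A0 k : 0 <= A k by exact: ces_avg_ge0.
(* The extra boundary term is what remains of the telescoping sum; it makes the induction close and
   is nonnegative. *)
suff : psum (fun k => A k `^ p) n + (q - 1) * (n%:R * A n `^ p)
       <= q * psum (fun k => A k `^ (p - 1) * a k) n.
  by apply: le_trans; rewrite lerDl !mulr_ge0 ?powR_ge0// subr_ge0 ltW.
elim: n => [|n IH]; first by rewrite !psum0 mul0r !mulr0 addr0.
rewrite !psumS mulrDr.
have aE : a n.+1 = n.+1%:R * A n.+1 - n%:R * A n.
  rewrite /A /ces_avg; case: n {IH} => [|n].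
    by rewrite mul0r subr0 mul1r invr1 mul1r psumS psum0 add0r.
  by rewrite !mulVKf ?pnatr_eq0// (psumS a n.+1) addrAC subrr add0r.
have PA : A n.+1 `^ p = A n.+1 * A n.+1 `^ (p - 1) by rewrite mulr_powRB1.
have young : A n * A n.+1 `^ (p - 1) <= A n `^ p / p + A n.+1 `^ p / q.
  by rewrite -(powRB1_conj (A n.+1)) conjugate_powR ?powR_ge0.
have qp : q / p = q - 1.
  by apply: (mulIf pN0); rewrite divfK// mulrBl mul1r mulrC conjugateM addrAC
    subrr add0r.
have {}young : q * (A n * A n.+1 `^ (p - 1)) <= (q - 1) * A n `^ p + A n.+1 `^
  p.
  have := ler_wpM2l (ltW q0) young.
  rewrite [X in _ <= X](_ : _ = q / p * A n `^ p + A n.+1 `^ p).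
    by rewrite qp.
  by field; rewrite pN0 qN0.
have n0 : 0 <= n%:R :> R by [].
have {}young := ler_wpM2l n0 young.
rewrite aE -[n.+1%:R]natr1.
rewrite PA in young *.
move: IH young; set S := psum _ n; set T := psum _ n.
move: (A n.+1 `^ (p - 1)) (A n `^ p) (A n.+1) (A n) n%:R.
by move=> y z b c' N; lra.
Qed.

(** Young's inequality, scaled so that half of the left side reappears on the right, is applied to
    the previous bound; that half is then absorbed. *)
Lemma hardy : exists2 H : R, 0 < H & forall a, (forall k, 0 <= a k) ->
  forall n, psum (fun k => ces_avg a k `^ p) n
    <= H * psum (fun k => a k `^ p) n.
Proof.
exists (2 * (q / p * (2 `^ q^-1) `^ p)).
  by rewrite mulr_gt0// mulr_gt0 ?divr_gt0 ?powR_gt0.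
move=> a a0 n; have := psum_ces_avg_powR n a0.
pose A := ces_avg a; have A0 k : 0 <= A k by exact: ces_avg_ge0.
set S := psum _ n; set T := psum (fun k => a k `^ p) n => h.
suff : q * psum (fun k => A k `^ (p - 1) * a k) n
    <= S / 2 + (q / p * (2 `^ q^-1) `^ p) * T by move: h; lra.
rewrite /S /T -psumZl -psumZr -psumZl -psumD; apply: ler_psum => k _.
(* As [t^q = 2], the factor [A k^(p-1) / t] contributes exactly [A k^p / 2] after multiplication by
   [q]. *)
set t : R := 2 `^ q^-1; have t0 : 0 < t by rewrite powR_gt0.
have := @conjugate_powR R (A k `^ (p - 1) / t) (t * a k) q p.
rewrite divr_ge0 ?powR_ge0 ?(ltW t0)// mulr_ge0 ?(ltW t0)// q0 p0.
rewrite [q^-1 + _]addrC hpq.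
rewrite mulrA divfK ?gt_eqF// => /(_ isT isT isT isT erefl).
move=> /(ler_wpM2l (ltW q0)) /le_trans; apply.
rewrite mulrDr mulrC divfK// powRM ?powR_ge0 ?invr_ge0 ?(ltW t0)//.
rewrite powRB1_conj powRM ?(ltW t0)// lerD//; last first.
  by rewrite -/t [leLHS](_ : _ = q / p * t `^ p * a k `^ p)//; ring.
rewrite -powR_inv1 ?(ltW t0)// -!powRrM.
by rewrite mulN1r mulrN mulVf// powRN powRr1.
Qed.

Lemma psum_uphalf (w : nat -> R) n :
  psum (fun m => w (uphalf m)) n.*2 = 2 * psum w n.
Proof.
elim: n => [|n IH]; first by rewrite !psum0 mulr0.
by rewrite doubleS !psumS IH /= doubleK uphalf_double; lra.
Qed.

(** Each [a k * d k] is spread over the window [k <= m < 2k]: there [1/m >= 1/(2k)] and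
    [d (uphalf m) >= d k], so the [k] summands recover half of it. Exchanging the sums produces the
    averages of [a], and Young's inequality finishes. Each value of [d] is met twice by [uphalf],
    whence [2 * D]. *)
Lemma psum_dual a d (B D : R) n :
  (forall k, 0 <= a k) -> (forall k, 0 <= d k) ->
  (forall k m, (0 < k <= m)%N -> d m <= d k) ->
  ces_bounded a B -> (forall n, psum (fun k => d k `^ q) n <= D) ->
  psum (fun k => a k * d k) n <= 2 * (B / p + 2 * D / q).
Proof.
move=> a0 d0 dd aB dD; rewrite -ler_pdivrMl// -psumZl.
pose e m := d (uphalf m); have e0 m : 0 <= e m by exact: d0.
apply: (@le_trans _ _ (psum (fun k =>
   \sum_(1 <= m < n.*2.+1) if (k <= m)%N then a k * (m%:R^-1 * e m) else 0) n)).
  apply: ler_psum => k /andP[k0 kn].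
  have kk : (k.*2 <= n.*2.+1)%N by rewrite (leq_trans _ (leqnSn _)) ?leq_double.
  have k2 : (k <= k.*2)%N by rewrite -addnn leq_addr.
  rewrite (@big_cat_nat _ _ _ k)//=; last exact: leq_trans kk.
  rewrite ler_wpDl ?sumr_ge0//.
    by move=> m _; case: ifP => _ //; rewrite !mulr_ge0 ?invr_ge0.
  rewrite (@big_cat_nat _ _ _ k.*2)//= ler_wpDr ?sumr_ge0//.
    by move=> m _; case: ifP => _ //; rewrite !mulr_ge0 ?invr_ge0.
  apply: (@le_trans _ _ (\sum_(k <= m < k.*2) (a k * ((k.*2)%:R^-1 * d k)))).
    have kR : k%:R != 0 :> R by rewrite pnatr_eq0 -lt0n.
    rewrite sumr_const_nat -[leRHS]mulr_natr -addnn addnK natrD.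
    rewrite [leRHS](_ : _ = 2^-1 * (a k * d k))//; field.
    by rewrite -natrD pnatr_eq0 -lt0n addn_gt0 k0.
  apply: ler_sum_nat => m /andP[km mk]; rewrite km ler_wpM2l// ler_pM
    ?invr_ge0//.
    by rewrite lef_pV2 ?posrE ?ltr0n ?double_gt0 ?(leq_trans k0)// ler_nat ltnW.
  apply: dd; rewrite leq_uphalf_double (ltnW mk) andbT.
  by case: m km {mk} => //; rewrite leqNgt k0.
rewrite [X in X <= _]exchange_big/=.
apply: (@le_trans _ _ (psum (fun m => ces_avg a m * e m) n.*2)).
  apply: ler_psum => m /andP[m0 mn].
  rewrite -big_mkcond -mulr_suml mulrA ler_wpM2r ?d0// mulrC ler_wpM2l
    ?invr_ge0//.
  have [nm|nm] := leqP m n.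
    by rewrite [leRHS](big_nat_widen 1 m.+1 n.+1).
  apply: le_trans (psum_homo a0 (ltnW nm)).
  by rewrite big_mkcond; apply: ler_psum => k _; case: ifP.
apply: (@le_trans _ _ (psum (fun m => ces_avg a m `^ p / p + e m `^ q / q)
  n.*2)).
  by apply: ler_psum => m _; rewrite conjugate_powR ?ces_avg_ge0.
rewrite psumD !psumZr lerD ?ler_pM2r ?invr_gt0//.
by rewrite (psum_uphalf (fun k => d k `^ q)) ler_pM2l.
Qed.

End CesaroSums.

(** * Uniform boundedness and test sequences *)

Section UniformBound.
Variables (R : realType) (p q : R).
Hypotheses (hp : 1 < p) (hpq : p^-1 + q^-1 = 1).
Implicit Types (a g u v w x y : nat -> R).

Let q1 : 1 < q := conjugate_gt1 hp hpq.
Let p0 : 0 < p := lt_trans ltr01 hp.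
Let q0 : 0 < q := lt_trans ltr01 q1.
Let pN0 : p != 0. Proof. by rewrite gt_eqF. Qed.

Lemma ces_boundedZ (c : R) a (A : R) : 0 <= c -> (forall k, 0 <= a k) ->
  ces_bounded p a A -> ces_bounded p (fun k => c * a k) (c `^ p * A).
Proof.
move=> c0 a0 aA n; rewrite (eq_psum (v := fun k => c `^ p * ces_avg a k `^ p)).
  by rewrite psumZl ler_wpM2l ?powR_ge0.
by move=> k _; rewrite ces_avgZ powRM// ces_avg_ge0.
Qed.

Lemma dconvZ (c d : R) u v n :
  dconv (fun k => c * u k) (fun k => d * v k) n = c * d * dconv u v n.
Proof. by rewrite /dconv mulr_sumr; apply: eq_bigr => k _; rewrite mulrACA. Qed.

Lemma psum_half_expr n : psum (fun j => 2^-1 ^+ j : R) n <= 1.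
Proof.
suff -> : psum (fun j => 2^-1 ^+ j : R) n = 1 - 2^-1 ^+ n.
  by rewrite gerBl exprn_ge0// invr_ge0.
elim: n => [|n IH]; first by rewrite psum0 expr0 subrr.
by rewrite psumS IH exprS; lra.
Qed.

(** A single average already has [p]-th power at most 1. This crude pointwise bound makes the
    weighted sums of a sequence of such [a] finite. *)
Lemma le_of_ces_bounded1 a n : (forall k, 0 <= a k) -> a 0%N = 0 ->
  ces_bounded p a 1 -> a n <= n%:R.
Proof.
move=> a0 a00 a1; case: n => [|n]; first by rewrite a00.
apply: (@le_trans _ _ (psum a n.+1)); first by rewrite ler_term_psum ?leqnn.
have avg0 := @ces_avg_ge0 R a ^~ a0.
have : ces_avg a n.+1 <= 1.
  rewrite leNgt; apply/negP => lt1; have := a1 n.+1; apply/negP; rewrite -ltNge.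
  apply: (@lt_le_trans _ _ (ces_avg a n.+1 `^ p)).
    have -> : 1 = 1 `^ p :> R by rewrite powR1.
    by rewrite gt0_ltr_powR ?nnegrE ?avg0.
  by rewrite (@ler_term_psum _ (fun k => ces_avg a k `^ p)) ?leqnn// => k;
    rewrite powR_ge0.
by rewrite /ces_avg ler_pdivrMl ?ltr0n// mulr1.
Qed.

(* The factor [2 `^ p] is lost because the supremum is approached only up to a
   factor 2. *)
Lemma ces_bounded_half_sum (a : nat -> nat -> R) :
  (forall j k, 0 <= a j k) -> (forall j, a j 0%N = 0) ->
  (forall j, ces_bounded p (a j) 1) ->
  exists x, [/\ forall k, 0 <= x k,
    forall j k, (0 < j)%N -> 2^-1 ^+ j * a j k <= x k &
    ces_bounded p x (2 `^ p)].
Proof.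
move=> a0 a00 a1.
have h0 j : 0 <= 2^-1 ^+ j :> R by rewrite exprn_ge0// invr_ge0.
pose xs k J := psum (fun j => 2^-1 ^+ j * a j k) J.
have xs0 k J : 0 <= xs k J by rewrite psum_ge0// => j; rewrite mulr_ge0.
have xsk k J : xs k J <= k%:R.
  apply: (@le_trans _ _ (psum (fun j => 2^-1 ^+ j) J * k%:R)).
    rewrite -psumZr; apply: ler_psum => j _.
    by rewrite ler_wpM2l// le_of_ces_bounded1.
  by rewrite ler_piMl// psum_half_expr.
have xs_homo k : {homo xs k : m n / (m <= n)%N >-> m <= n}.
  by apply: psum_homo => j; rewrite mulr_ge0.
pose x k := sup (range (xs k)).
have xsup k : has_sup (range (xs k)).
  by split; [exists (xs k 0%N), 0%N|exists k%:R => _ [J _ <-]].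
have xsx k J : xs k J <= x k.
  by apply: sup_upper_bound => //; exists J.
have x0 k : 0 <= x k := le_trans (xs0 k 0%N) (xsx k 0%N).
exists x; split => //.
  move=> j k j0; apply: le_trans (xsx k j).
  by rewrite (@ler_term_psum _ (fun j => 2^-1 ^+ j * a j k)) ?j0 ?leqnn// => i;
    rewrite mulr_ge0.
have near_sup k : exists J, x k <= 2 * xs k J.
  have [xk0|xk0] := leP (x k) 0.
    by exists 0%N; rewrite (le_trans xk0)// mulr_ge0.
  have [|_ [J _ <-] xJ] := @sup_adherent _ _ (x k / 2) _ (xsup k).
    by rewrite divr_gt0.
  by exists J; move: xJ; rewrite -/(x k); lra.
move=> n.
(* Only the indices up to [n] matter, so one finite [J] serves them all and the estimate reduces to
   finite sums. *)
have [J xJ] : exists J, forall k, (k <= n)%N -> x k <= 2 * xs k J.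
  elim: n => [|n [J IH]].
    by have [J xJ] := near_sup 0%N; exists J => k; rewrite leqn0 => /eqP ->.
  have [J' xJ'] := near_sup n.+1; exists (maxn J J') => k.
  rewrite leq_eqVlt => /predU1P[->|/IH xk].
    by apply: le_trans xJ' _; rewrite ler_pM2l// xs_homo// leq_maxr.
  by apply: le_trans xk _; rewrite ler_pM2l// xs_homo// leq_maxl.
have avgJ m : ces_avg (xs ^~ J) m = psum (fun j => 2^-1 ^+ j * ces_avg (a j) m)
  J.
  rewrite /ces_avg [psum _ m]exchange_big/= -psumZl.
  by apply: eq_psum => j _; rewrite -mulr_sumr mulrCA.
apply: (@le_trans _ _ (2 `^ p * psum (fun m => ces_avg (xs ^~ J) m `^ p) n)).
  rewrite -psumZl; apply: ler_psum => m /andP[m0 mn].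
  rewrite -powRM ?ces_avg_ge0// ge0_ler_powR ?(ltW p0) ?nnegrE ?mulr_ge0
    ?invr_ge0 ?psum_ge0//.
  rewrite /ces_avg mulrCA ler_wpM2l ?invr_ge0// -psumZl ler_psum// => k /andP[_
    km].
  by rewrite xJ// (leq_trans km).
rewrite ler_piMr ?powR_ge0//.
apply: (@le_trans _ _ (psum (fun m => psum (fun j => 2^-1 ^+ j * ces_avg (a j) m
  `^ p) J) n)).
  apply: ler_psum => m _; rewrite avgJ.
  (* Convexity with the weights [2^-j], of total at most 1. *)
  apply: le_trans (powR_jensen hp hpq ltr01 h0 _ (psum_half_expr J)) _.
    by move=> j; rewrite ces_avg_ge0.
  by rewrite powR1 mul1r.
rewrite [X in X <= _]exchange_big/=; apply: le_trans (psum_half_expr J).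
by apply: ler_psum => j _; rewrite -mulr_sumr ler_piMr//; exact: (a1 j n).
Qed.

(** * Boundedness of the bilinear convolution map *)

Section Multiplier.
Variable beta : nat -> R.
Hypothesis beta0 : forall k, 0 <= beta k.
Hypothesis conv_bounded : forall a g (A B : R),
  (forall k, 0 <= a k) -> (forall k, 0 <= g k) ->
  ces_bounded p a A -> ces_bounded p g B ->
  exists C : R, ces_bounded p (dconv (fun k => a k * beta k) g) C.

(** In [conv_bounded] the bound depends on the pair. If no common bound existed, pairs with ever
    larger convolutions could be packed into one pair [(x, y)] dominating [2^-j] times each; by
    monotonicity the convolution of [x] and [y] would have no finite bound. *)
Lemma conv_uniformly_bounded : exists2 C : R, 0 < C & forall a g,
  (forall k, 0 <= a k) -> (forall k, 0 <= g k) -> a 0%N = 0 -> g 0%N = 0 ->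
  ces_bounded p a 1 -> ces_bounded p g 1 ->
  ces_bounded p (dconv (fun k => a k * beta k) g) C.
Proof.
apply: contrapT => unb.
have {unb} unb (C : R) : 0 < C -> exists t : (nat -> R) * (nat -> R) * nat,
    [/\ (forall k, 0 <= t.1.1 k) /\ (forall k, 0 <= t.1.2 k),
        t.1.1 0%N = 0 /\ t.1.2 0%N = 0,
        ces_bounded p t.1.1 1 /\ ces_bounded p t.1.2 1 &
        C < psum (fun m => ces_avg (dconv (fun k => t.1.1 k * beta k) t.1.2) m
          `^ p) t.2].
  move=> C0; apply: contrapT => h; apply: unb;
    exists C => // a g a0 g0 a00 g00 a1 g1 n.
  by rewrite leNgt; apply/negP => Cn; apply: h; exists (a, g, n).
(* The power of 4 compensates the two weights [2^-j], one from each factor; the factor [j.+1]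
   remains and tends to infinity. *)
have pos j : 0 < j.+1%:R * ((4 ^+ j.+1) `^ p) :> R.
  by rewrite mulr_gt0 ?ltr0n// powR_gt0 exprn_gt0.
have /choice[t ht] j := unb _ (pos j).
(* Shifted by one, since the weighted sums start at [j = 1]. *)
pose a j := (t j.-1).1.1; pose g j := (t j.-1).1.2.
have a0 j k : 0 <= a j k by have [[+ _] _ _ _] := ht j.-1; apply.
have g0 j k : 0 <= g j k by have [[_ +] _ _ _] := ht j.-1; apply.
have [x [x0 xa xb]] : exists x, [/\ forall k, 0 <= x k,
    forall j k, (0 < j)%N -> 2^-1 ^+ j * a j k <= x k & ces_bounded p x (2 `^
      p)].
  by apply: ces_bounded_half_sum => // j; have [_ [? _] [? _] _] := ht j.-1.
have [y [y0 yg yb]] : exists y, [/\ forall k, 0 <= y k,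
    forall j k, (0 < j)%N -> 2^-1 ^+ j * g j k <= y k & ces_bounded p y (2 `^
      p)].
  by apply: ces_bounded_half_sum => // j; have [_ [_ ?] [_ ?] _] := ht j.-1.
have [C hC] := conv_bounded x0 y0 xb yb.
have [j Cj] : exists j : nat, C < j.+1%:R.
  exists (Num.truncn C); exact: truncnS_gt.
have [_ _ _ /=] := ht j; rewrite -/(a j.+1) -/(g j.+1); set n := (t j).2.
set S := psum _ n => big.
have h0 : 0 <= 2^-1 ^+ j.+1 :> R by rewrite exprn_ge0// invr_ge0.
have four0 : 0 < 4 ^+ j.+1 :> R by rewrite exprn_gt0.
have : (4 ^+ j.+1)^-1 `^ p * S <= C.
  apply: le_trans (hC n).
  apply: (@le_trans _ _ (psum (fun m => ces_avg
      (dconv (fun k => (2^-1 ^+ j.+1 * a j.+1 k) * beta k) (fun k => 2^-1 ^+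
        j.+1 * g j.+1 k)) m `^ p) n)).
    rewrite -psumZl; apply: ler_psum => m _.
    rewrite -powRM ?invr_ge0 ?(ltW four0) ?ces_avg_ge0//; last first.
      by move=> k; apply: dconv_ge0 => // i; rewrite mulr_ge0.
    rewrite -ces_avgZ le_eqVlt; apply/orP; left; apply/eqP; congr (_ `^ p).
    congr (_ * _); apply: eq_psum => k _.
    rewrite (_ : (fun k => _ * _ * beta k) = (fun k => 2^-1 ^+ j.+1 * (a j.+1 k
      * beta k))); last first.
      by apply/funext => i; rewrite mulrA.
    rewrite dconvZ -exprVn -exprMn; congr (_ ^+ _ * _).
    by rewrite -invfM -natrM.
  apply: ler_psum_ces => // m; rewrite dconv_ge0 ?ler_dconv//.
  - by move=> k; rewrite !mulr_ge0//= ler_wpM2r// xa.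
  - by move=> k; rewrite mulr_ge0//= yg.
  - by move=> k; rewrite !mulr_ge0.
  - by move=> k; rewrite mulr_ge0.
apply/negP; rewrite -ltNge; apply: lt_trans Cj _.
rewrite -ltr_pdivrMl ?powR_gt0 ?invr_gt0//.
by rewrite mulrC -[(4 ^+ _)^-1]powR_inv1 ?ltW// powRAC powR_inv1 ?powR_ge0//
  invrK.
Qed.

(** Homogeneity: [A] and [B] bound [p]-th powers, so the normalising factors are [A^(-1/p)] and
    [B^(-1/p)]. *)
Lemma conv_bounded_mul : exists2 C : R, 0 < C & forall a g (A B : R),
  (forall k, 0 <= a k) -> (forall k, 0 <= g k) -> a 0%N = 0 -> g 0%N = 0 ->
  0 < A -> 0 < B -> ces_bounded p a A -> ces_bounded p g B ->
  ces_bounded p (dconv (fun k => a k * beta k) g) (C * (A * B)).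
Proof.
have [C C0 hC] := conv_uniformly_bounded; exists C => // a g A B a0 g0 a00 g00
  A0 B0 aA gB.
have norm u (U : R) : (forall k, 0 <= u k) -> 0 < U -> ces_bounded p u U ->
    ces_bounded p (fun k => U `^ (- p^-1) * u k) 1.
  move=> u0 U0 uU; have := ces_boundedZ (powR_ge0 U (- p^-1)) u0 uU.
  by rewrite -powRrM mulNr mulVf// powR_inv1 ?ltW// mulVf ?gt_eqF.
have scale0 u (U : R) : (forall k, 0 <= u k) -> forall k,
  0 <= U `^ (- p^-1) * u k.
  by move=> u0 k; rewrite mulr_ge0 ?powR_ge0.
have z u (U : R) : u 0%N = 0 -> U `^ (- p^-1) * u 0%N = 0 by move=> ->;
  rewrite mulr0.
have hn := hC _ _ (scale0 _ A a0) (scale0 _ B g0) (z _ A a00) (z _ B g00)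
  (norm _ _ a0 A0 aA) (norm _ _ g0 B0 gB).
have AB : 0 <= A `^ p^-1 * B `^ p^-1 by rewrite mulr_ge0 ?powR_ge0.
have d0 k : 0 <= dconv (fun k => A `^ (- p^-1) * a k * beta k)
    (fun k => B `^ (- p^-1) * g k) k.
  by apply: dconv_ge0 => i; rewrite ?mulr_ge0 ?powR_ge0.
have := ces_boundedZ AB d0 hn.
rewrite powRM ?powR_ge0// -!powRrM mulVf// !powRr1 ?(ltW A0) ?(ltW B0)//.
rewrite [A * B * C]mulrC.
move=> h n; apply: le_trans (h n).
apply: ler_psum => m _; rewrite le_eqVlt; apply/orP; left; apply/eqP.
congr (ces_avg _ _ `^ p); apply/funext => k.
  rewrite (_ : (fun k => _ * _ * beta k) = (fun k => A `^ (- p^-1) * (a k * beta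
    k))); last first.
    by apply/funext => i; rewrite mulrA.
  by rewrite dconvZ mulrA mulrACA !powRN !mulfV ?mul1r ?gt_eqF ?powR_gt0.
Qed.

(** * Test sequences and the dual bound *)

Lemma harmonic_unbounded (x : R) : exists n, x < psum (fun k => k%:R^-1) n.
Proof.
apply: contrapT => h; apply: (@dvg_harmonic R).
have hx n : series harmonic n <= x.
  rewrite leNgt; apply/negP => xn; apply: h; exists n.
  by rewrite /psum big_add1.
apply: nondecreasing_is_cvgn; last by exists x => _ [n _ <-].
by apply: nondecreasing_series => n _ _; rewrite invr_ge0.
Qed.

Lemma psum_trunc_le u (M n : nat) : (forall k, 0 <= u k) ->
  psum (fun k => if (k <= M)%N then u k else 0) n <= psum u M.
Proof.
move=> u0; have [nM|Mn] := leqP n M.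
  apply: le_trans (psum_homo u0 nM); apply: ler_psum => k _.
  by case: ifP.
rewrite /psum -big_mkcond/= (big_nat_widen 1 M.+1 n.+1)//.
exact: leqW.
Qed.

(* The sequence whose partial sums are [minn n M `^ q^-1]; it nearly attains
   the norm of the convolution operators as [M] grows. *)
Lemma test_sequence : exists2 Z : R, 0 < Z & forall M, exists g,
  [/\ forall k, 0 <= g k, g 0%N = 0,
      forall n, psum g n = (minn n M)%:R `^ q^-1 &
      ces_bounded p g (psum (fun k => k%:R^-1) M + Z)].
Proof.
have [Z Z0 hZ] := zeta_bounded hp; exists Z => // M.
have qV0 : 0 < q^-1 by rewrite invr_gt0.
pose S n : R := (minn n M)%:R `^ q^-1.
have S_homo m n : (m <= n)%N -> S m <= S n.
  move=> mn; rewrite ge0_ler_powR ?nnegrE ?ler0n ?(ltW qV0)// ler_nat.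
  by rewrite leq_min geq_minr andbT (leq_trans (geq_minl _ _)).
pose g n := S n - S n.-1.
have gS n : psum g n = S n.
  elim: n => [|n IH]; first by rewrite psum0 /S min0n powR0 ?gt_eqF.
  by rewrite psumS IH /g/= addrCA subrr addr0.
exists g; split => //.
- by move=> k; rewrite subr_ge0 S_homo// leq_pred.
- by rewrite /g subrr.
move=> n; have [M00|M0] := posnP M.
  rewrite M00 psum0 add0r (eq_psum (v := fun=> 0)) ?[psum _ _]big1 ?ltW//.
  by move=> k _; rewrite /ces_avg gS /S M00 minn0 powR0 ?gt_eqF// mulr0 powR0.
pose delta (k : nat) : R := (k == 1%N)%:R.
have delta0 k : 0 <= delta k by rewrite ler0n.
have psum_delta k : (0 < k)%N -> psum delta k = 1.
  case: k => // k _; elim: k => [|k IH]; first by rewrite psumS psum0 add0r.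
  by rewrite psumS IH addr0.
have bounded_delta : ces_bounded p delta Z.
  move=> m; apply: le_trans (hZ m); apply: ler_psum => k /andP[k0 _].
  by rewrite /ces_avg psum_delta// mulr1 -powR_inv1 ?ler0n// -powRrM mulN1r.
have MR : 0 < M%:R :> R by rewrite ltr0n.
pose u (k : nat) : R := if (k <= M)%N then k%:R^-1 else 0.
(* Up to [M] the [p]-th power of the average is exactly [1/k]. Beyond [M] it is [M^(p-1) k^(-p)],
   the dilation by [M] of the case of a unit mass at 1; the dilation bound cancels [M^(p-1)], so the
   tail costs only [Z], whatever [M] is. *)
pose v (k : nat) : R := (k%:R^-1 * psum delta (k %/ M)) `^ p.
apply: (@le_trans _ _ (psum (fun k => u k + M%:R `^ (p - 1) * v k) n)).
  apply: ler_psum => k /andP[k0 _]; have kR : 0 < k%:R :> R by rewrite ltr0n.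
  rewrite /ces_avg gS /S powRM ?invr_ge0 ?powR_ge0// (powRV_conj hp hpq) /u.
  have [kM|Mk] := leqP k M.
    rewrite ler_wpDr ?mulr_ge0 ?powR_ge0//.
    rewrite -(powR_inv1 (ltW kR)) -powRrM -powRD ?(gt_eqF kR) ?implybT//.
    by rewrite (_ : -1 * p + (p - 1) = -1)//; ring.
  rewrite /= add0r /v psum_delta ?mulr1 1?mulrC//.
  by rewrite divn_gt0// ltnW.
rewrite psumD lerD//; first by apply: psum_trunc_le => k; rewrite invr_ge0.
rewrite psumZl.
have := psum_ces_shift hp n M0 bounded_delta delta0.
move=> /(ler_wpM2l (powR_ge0 M%:R (p - 1)))/le_trans; apply.
rewrite mulrA -powRD ?(gt_eqF MR) ?implybT//.
by rewrite (_ : p - 1 + (1 - p) = 0) ?powRr0 ?mul1r//; ring.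
Qed.

(** The integer quotient loses at most a factor 2: [n < (n %/ k + 1) * k <= 2 * (n %/ k) * k]. *)
Lemma ler_divn_powR (n k : nat) : (0 < k <= n)%N ->
  2^-1 `^ q^-1 * (n%:R `^ q^-1 * k%:R `^ (- q^-1)) <= (n %/ k)%:R `^ q^-1 :> R.
Proof.
move=> /andP[k0 kn]; have kR : 0 < k%:R :> R by rewrite ltr0n.
rewrite -mulN1r powRrM powR_inv1 ?(ltW kR)//.
rewrite -!powRM ?mulr_ge0 ?invr_ge0//; apply: ge0_ler_powR.
- by rewrite invr_ge0 ltW.
- by rewrite nnegrE !mulr_ge0 ?invr_ge0.
- by rewrite nnegrE.
rewrite mulrA ler_pdivrMr// ler_pdivrMl// -!natrM ler_nat.
have := ltn_ceil n k0; rewrite mulSn => h.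
have nk : (0 < n %/ k)%N by rewrite divn_gt0.
rewrite mul2n -addnn (leq_trans (ltnW h))// leq_add2r.
by rewrite leq_pmull.
Qed.

(** Against the test sequence, the average of the convolution at [K < n <= M] is at least a constant
    times [X * n^(1/q) / n], with [p]-th power of order [X^p / n]. Summing gives [X^p] times a
    harmonic sum, while the norm of the test sequence grows like the same harmonic sum; the two
    cancel. *)
Lemma dual_bounded : exists2 C : R, 0 < C & forall a (A : R) K,
  (forall k, 0 <= a k) -> a 0%N = 0 -> 0 < A -> ces_bounded p a A ->
  (psum (fun k => a k * (beta k * k%:R `^ (- q^-1))) K) `^ p <= C * A.
Proof.
have [C C0 hC] := conv_bounded_mul; have [Z Z0 test] := test_sequence.
pose t : R := (2^-1 `^ q^-1) `^ p.
have t0 : 0 < t by rewrite !powR_gt0// invr_gt0.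
exists (4 * C / t); first by rewrite divr_gt0 ?mulr_gt0.
move=> a A K a0 a00 A0 aA; set X := psum _ K.
have X0 : 0 <= X by apply: psum_ge0 => k; rewrite !mulr_ge0 ?powR_ge0.
pose H n := psum (fun k => k%:R^-1 : R) n.
(* This [M] yields both [H M - H K >= H M / 2] and [H M + Z <= 2 * H M], whence the constant 4. *)
have [M HM] := harmonic_unbounded (2 * H K + Z).
have H0 n : 0 <= H n by apply: psum_ge0 => k; rewrite invr_ge0.
have KM : (K <= M)%N.
  rewrite leqNgt; apply/negP => MK.
  have : H M <= H K by apply: psum_homo (ltnW MK) => k; rewrite invr_ge0.
  by move: HM (H0 K); rewrite -/(H M); lra.
have [g [g0 g00 gS gB]] := test M.
have HZ : 0 < H M + Z by have := H0 M; lra.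
have bound := hC a g A _ a0 g0 a00 g00 A0 HZ aA gB M.
have : t * X `^ p * (H M - H K) <= C * (A * (H M + Z)).
  apply: le_trans bound.
  rewrite /H /psum [X in X - _](@big_cat_nat _ _ _ K.+1)//= addrAC subrr add0r.
  rewrite mulr_sumr [leRHS](@big_cat_nat _ _ _ K.+1)//= ler_wpDl ?sumr_ge0//.
    by move=> k _; rewrite powR_ge0.
  apply: ler_sum_nat => n /andP[Kn nM].
  have nR : 0 < n%:R :> R by rewrite ltr0n (leq_trans _ Kn).
  have nE : n%:R^-1 = (n%:R^-1 * n%:R `^ q^-1) `^ p :> R.
    rewrite powRM ?invr_ge0 ?powR_ge0 ?(ltW nR)// (powRV_conj hp hpq).
    rewrite -(powR_inv1 (ltW nR)) -powRrM -powRD ?(gt_eqF nR) ?implybT//.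
    by rewrite (_ : -1 * p + (p - 1) = -1)//; ring.
  rewrite [X in _ * X <= _]nE /t -!powRM ?mulr_ge0 ?invr_ge0 ?powR_ge0//.
  have d0 k : 0 <= dconv (fun k => a k * beta k) g k.
    by apply: dconv_ge0 => // i; rewrite mulr_ge0.
  rewrite ge0_ler_powR ?nnegrE ?ces_avg_ge0 ?(ltW p0) ?mulr_ge0 ?invr_ge0
    ?powR_ge0//.
  rewrite mulrCA /ces_avg ler_wpM2l ?invr_ge0// psum_dconv.
  rewrite mulrAC mulrC -psumZr.
  apply: (@le_trans _ _ (psum (fun k => a k * beta k * psum g (n %/ k)) K)).
    apply: ler_psum => k /andP[k0 kK]; rewrite mulrA -[leLHS]mulrA ler_wpM2l
      ?mulr_ge0//.
    rewrite gS (minn_idPl _); last first.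
      by rewrite (leq_trans (leq_div _ _)).
    rewrite mulrC -mulrA ler_divn_powR// k0.
    by rewrite (leq_trans kK)// ltnW.
  apply: psum_homo (ltnW Kn) => k.
  by rewrite !mulr_ge0 ?psum_ge0.
have HKM : H M / 2 <= H M - H K by move: HM; rewrite -/(H M); lra.
have HZM : H M + Z <= 2 * H M by move: HM (H0 K); rewrite -/(H M); lra.
have HM0 : 0 < H M by move: HM (H0 K); rewrite -/(H M); lra.
move=> h.
have : t * X `^ p * (H M / 2) <= C * (A * (2 * H M)).
  apply: le_trans (le_trans _ h) _.
    by rewrite ler_wpM2l// mulr_ge0 ?powR_ge0 ?ltW.
  by rewrite ler_pM2l// ler_pM2l.
have -> : C * (A * (2 * H M)) = 4 * C * A * (H M / 2) by field.
rewrite ler_pM2r ?divr_gt0// => {}h.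
by rewrite [leRHS](_ : _ = (4 * C * A) / t) ?ler_pdivlMr 1?mulrC//; ring.
Qed.

(** The test sequence [a] places the mass [v n = c (kappa n)^(q-1)] at [kappa n], so its pairing
    with [c] is [D]. Hardy's inequality and [(q-1) p = q] bound its norm through [H * D]. Then
    [D^p <= C * H * D], and the finite number [D] can be cancelled. *)
Lemma selection_bounded : exists D : R, forall (kappa : nat -> nat) M,
  (forall n, (n <= kappa n)%N) ->
  psum (fun n => (beta (kappa n) * (kappa n)%:R `^ (- q^-1)) `^ q) M <= D.
Proof.
have [C C0 hC] := dual_bounded; have [H H0 hH] := hardy hp hpq.
exists ((C * H) `^ (p - 1)^-1) => kappa M kn.
pose c k := beta k * k%:R `^ (- q^-1).
have c0 k : 0 <= c k by rewrite mulr_ge0 ?powR_ge0.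
set D := psum _ M.
have D0 : 0 <= D by apply: psum_ge0 => n; exact: powR_ge0.
move: D0; rewrite le_eqVlt => /predU1P[<-|D0]; first exact: powR_ge0.
pose v n := c (kappa n) `^ (q - 1).
pose u n := if (n <= M)%N then v n else 0.
have u0 n : 0 <= u n by rewrite /u; case: ifP => _ //; exact: powR_ge0.
pose a k := psum (fun n => if (0 < k)%N && (kappa n == k) then v n else 0) M.
have v0 n : 0 <= v n by exact: powR_ge0.
have a0 k : 0 <= a k by apply: psum_ge0 => n; case: ifP.
have a00 : a 0%N = 0 by rewrite /a [LHS]big1.
(* Summing up to [K] catches every mass of [a]. *)
pose K := (\max_(1 <= n < M.+1) kappa n)%N.
have psum_pick N (w : nat -> R) n : (0 < n)%N ->
    psum (fun k => if (0 < k)%N && (kappa n == k) then w k else 0) N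
    = if (kappa n <= N)%N then w (kappa n) else 0.
  move=> n0; have kn0 : (0 < kappa n)%N := leq_trans n0 (kn n).
  elim: N => [|N IH]; first by rewrite psum0 leqn0 gtn_eqF.
  rewrite psumS IH /= [(_ <= N.+1)%N]leq_eqVlt ltnS.
  case: eqVneq => [->|_] /=; first by rewrite ltnn add0r.
  by rewrite addr0.
(* Since [kappa n >= n], masses only move to the right, which lowers every partial sum. *)
have au N : psum a N <= psum u N.
  rewrite /a /psum exchange_big/=.
  apply: (@le_trans _ _ (psum (fun n => if (n <= N)%N then v n else 0) M)).
    apply: ler_psum => n /andP[n0 _]; rewrite -/(psum _ N).
    rewrite (psum_pick N (fun=> v n))//.
    case: ifP => knN; last by case: ifP.
    by rewrite (leq_trans (kn n)).
  have [MN|NM] := leqP M N; last first.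
    apply: le_trans (psum_trunc_le N M v0) _.
    by apply: ler_psum => n /andP[_ nN]; rewrite /u (leq_trans nN (ltnW NM)).
  apply: le_trans (psum_homo u0 MN); apply: ler_psum => n /andP[_ nM].
  by rewrite /u nM; case: ifP.
have aH : ces_bounded p a (H * D).
  move=> n; apply: (@le_trans _ _ (psum (fun k => ces_avg u k `^ p) n)).
    apply: ler_psum => k _; apply: ge0_ler_powR;
      rewrite ?nnegrE ?ces_avg_ge0 ?(ltW p0)//.
    by rewrite ler_wpM2l ?invr_ge0.
  apply: le_trans (hH u u0 n) _; rewrite ler_pM2l//.
  apply: le_trans (psum_trunc_le M n _); last by move=> k; exact: powR_ge0.
  apply: ler_psum => k _; rewrite /u; case: ifP => _; last by rewrite powR0.
  by rewrite /v -powRrM (_ : (q - 1) * p = q) // mulrBl mul1r mulrC (conjugateM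
    hp hpq) addrAC subrr add0r.
have := hC a (H * D) K a0 a00 (mulr_gt0 H0 D0) aH.
have -> : psum (fun k => a k * c k) K = D.
  rewrite /a; under eq_psum do rewrite -psumZr.
  rewrite [LHS]exchange_big/=; apply: eq_psum => n /andP[n0 nM].
  rewrite (eq_bigr (fun k => if (0 < k)%N && (kappa n == k) then v n * c k else
    0)); last first.
    by move=> k _; case: ifP => _ //; rewrite mul0r.
  rewrite -/(psum _ K) (psum_pick K (fun k => v n * c k))// ifT.
    by rewrite /v mulrC mulr_powRB1.
  apply: (@leq_bigmax_seq _ _ xpredT kappa) => //.
  by rewrite mem_index_iota n0.
rewrite -(mulr_powRB1 (ltW D0) p0) mulrA [C * H * D]mulrC mulrC.
rewrite mulrC ler_pM2l// => h.
have pB : 0 < p - 1 by rewrite subr_gt0.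
have -> : D = (D `^ (p - 1)) `^ (p - 1)^-1.
  by rewrite -powRrM mulfV ?gt_eqF// powRr1 ?ltW.
by apply: ge0_ler_powR; rewrite ?nnegrE ?powR_ge0 ?invr_ge0 ?(ltW pB) ?mulr_ge0
  ?(ltW C0) ?(ltW H0).
Qed.
End Multiplier.
End UniformBound.

(** * Dirichlet series *)

Section ComplexSequences.
Variable R : realType.
Implicit Types (z w : nat -> R[i]) (l m : R[i]).

Lemma normc_ge0 (x : R[i]) : 0 <= normc x.
Proof. by case: x => a b; rewrite sqrtr_ge0. Qed.

Lemma norm_normc (x : R[i]) : `|x| = (normc x)%:C.
Proof. by []. Qed.

Lemma normc_real (x : R) : normc x%:C = `|x|.
Proof. by rewrite /= expr0n addr0 sqrtr_sqr. Qed.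

Lemma normcB_sym (x y : R[i]) : normc (x - y) = normc (y - x).
Proof. by rewrite -normcN opprB. Qed.

Lemma ler_absRe_normc (x : R[i]) : `|complex.Re x| <= normc x.
Proof. by have := normc_ge_Re x; rewrite norm_normc lecR. Qed.

Lemma ler_absIm_normc (x : R[i]) : `|complex.Im x| <= normc x.
Proof.
case: x => a b /=; rewrite -(sqrtr_sqr b) ler_wsqrtr// lerDr.
by rewrite sqr_ge0.
Qed.

Lemma normc_le_ReIm (x : R[i]) : normc x <= `|complex.Re x| + `|complex.Im x|.
Proof.
case: x => a b /=; rewrite -[leRHS]ger0_norm ?addr_ge0// -sqrtr_sqr.
rewrite ler_wsqrtr// sqrrD !real_normK ?num_real//.
by rewrite addrAC lerDl mulrn_wge0// mulr_ge0.
Qed.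

Lemma normc_psum z n : normc (psum z n) <= psum (@normc R \o z) n.
Proof.
elim: n => [|n IH]; first by rewrite !psum0 normc0.
by rewrite !psumS (le_trans (le_normcD _ _))// lerD2r.
Qed.

(** The norm of [R[i]] is complex-valued, and a positive radius there has zero imaginary part; this
    form allows real radii throughout. *)
Lemma cvgCP z l : (z : nat -> R[i]^o) @ \oo --> (l : R[i]^o) <->
  forall e : R, 0 < e -> exists N, forall n, (N <= n)%N -> normc (z n - l) <= e.
Proof.
split=> [/cvgrPdist_le zl e e0|zl].
  have [|N _ hN] := zl e%:C; first by rewrite ltcR.
  by exists N => n /hN /=; rewrite norm_normc lecR normcB_sym.
apply/cvgrPdist_le => e; rewrite ltcE /= => /andP[/eqP ei e0].
have [N hN] := zl _ e0; exists N => // n /= /hN.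
rewrite normcB_sym norm_normc => h.
by rewrite lecE /= ei eqxx.
Qed.

Lemma cvgCD z w l m : (z : nat -> R[i]^o) @ \oo --> (l : R[i]^o) ->
  (w : nat -> R[i]^o) @ \oo --> (m : R[i]^o) ->
  ((fun n => z n + w n) : nat -> R[i]^o) @ \oo --> (l + m : R[i]^o).
Proof.
move=> /cvgCP zl /cvgCP wm; apply/cvgCP => e e0.
have e2 : 0 < e / 2 by rewrite divr_gt0.
have [N hN] := zl _ e2; have [M hM] := wm _ e2.
exists (maxn N M) => n; rewrite geq_max => /andP[Nn Mn].
have -> : z n + w n - (l + m) = (z n - l) + (w n - m) by ring.
rewrite (splitr e).
by rewrite (le_trans (le_normcD _ _))// lerD ?hN ?hM.
Qed.

Lemma cvgC_mulr z l (c : R[i]) : (z : nat -> R[i]^o) @ \oo --> (l : R[i]^o) ->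
  ((fun n => z n * c) : nat -> R[i]^o) @ \oo --> (l * c : R[i]^o).
Proof.
move=> /cvgCP zl; apply/cvgCP => e e0.
have c1 : 0 < normc c + 1 by rewrite ltr_wpDl// normc_ge0.
have [|N hN] := zl (e / (normc c + 1)); first by rewrite divr_gt0.
exists N => n /hN h; rewrite -mulrBl normcM.
apply: le_trans (ler_wpM2r (normc_ge0 c) h) _.
by rewrite -mulrA ler_piMr ?(ltW e0)// ler_pdivrMl// mulr1 lerDl ler01.
Qed.

Lemma cvgC_normc_le z l (B : R) :
  (z : nat -> R[i]^o) @ \oo --> (l : R[i]^o) ->
  (forall n, normc (z n) <= B) -> normc l <= B.
Proof.
move=> /cvgCP zl zB; apply/ler_addgt0Pr => e e0.
have [N hN] := zl e e0.
rewrite -[l](subrK (z N)) addrC (le_trans (le_normcD _ _))// lerD//.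
by rewrite normcB_sym hN.
Qed.

Lemma cvgC_bounded z l : (z : nat -> R[i]^o) @ \oo --> (l : R[i]^o) ->
  exists B : R, forall n, normc (z n - l) <= B.
Proof.
move=> /cvgCP/(_ 1 ltr01)[N hN].
exists (1 + \sum_(0 <= k < N) normc (z k - l)) => n.
have s0 i : 0 <= normc (z i - l) by exact: normc_ge0.
have [Nn|nN] := leqP N n.
  by rewrite (le_trans (hN _ Nn))// lerDl sumr_ge0.
by rewrite (big_rem n) ?mem_index_iota//= addrCA lerDl addr_ge0 ?sumr_ge0.
Qed.

Lemma cvg_psum_abs (x : nat -> R) (B : R) :
  (forall n, psum (fun k => `|x k|) n <= B) -> cvgn (psum x).
Proof.
move=> xB; have psumE (u : nat -> R) : psum u = series (fun k => u k.+1).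
  by apply/funext => n; rewrite /psum big_add1.
rewrite psumE; apply: normed_cvg; rewrite /= -[X in cvgn X]/(series _).
rewrite -(psumE (fun k => `|x k|)).
apply: nondecreasing_is_cvgn; last by exists B => _ [n _ <-].
by move=> m n mn; apply: psum_homo.
Qed.

Lemma cvgC_psum z (B : R) : (forall n, psum (@normc R \o z) n <= B) ->
  exists l, (psum z : nat -> R[i]^o) @ \oo --> (l : R[i]^o).
Proof.
move=> zB.
have /cvg_ex[/= x /cvgrPdist_le cx] : cvgn (psum (fun k => complex.Re (z k))).
  apply: (@cvg_psum_abs _ B) => n; apply: le_trans (zB n).
  by apply: ler_psum => k _; rewrite ler_absRe_normc.
have /cvg_ex[/= y /cvgrPdist_le cy] : cvgn (psum (fun k => complex.Im (z k))).
  apply: (@cvg_psum_abs _ B) => n; apply: le_trans (zB n).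
  by apply: ler_psum => k _; rewrite ler_absIm_normc.
exists (x +i* y); apply/cvgCP => e e0.
have e2 : 0 < e / 2 by rewrite divr_gt0.
have [N _ hN] := cx _ e2; have [M _ hM] := cy _ e2.
exists (maxn N M) => n; rewrite geq_max => /andP[Nn Mn].
have -> : psum z n = psum (fun k => complex.Re (z k)) n +i* psum (fun k =>
  complex.Im (z k)) n.
  elim: n {Nn Mn} => [|n IH]; first by rewrite !psum0.
  by rewrite !psumS IH; case: (z n.+1).
rewrite (le_trans (normc_le_ReIm _))//= (splitr e) lerD//.
  by rewrite distrC; exact: hN.
by rewrite distrC; exact: hM.
Qed.

Lemma psum_bounded_tail (u : nat -> R) (U e : R) : 0 < e ->
  (forall k, 0 <= u k) -> (forall n, psum u n <= U) ->
  exists K, forall n, (K <= n)%N -> psum u n - psum u K <= e.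
Proof.
move=> e0 u0 uU.
have hs : has_sup (range (psum u)).
  by split; [exists (psum u 0%N), 0%N|exists U => _ [n _ <-]].
have [_ [K _ <-] hK] := sup_adherent e0 hs.
exists K => n Kn.
have : psum u n <= sup (range (psum u)) by apply: sup_upper_bound => //;
  exists n.
by move: hK; lra.
Qed.

(** Replacing [psum v (n %/ k)] by [G] plus an error leaves [psum u n * G] and a remainder. For
    [k <= K] the error is small because [n %/ k] is large; for [k > K] it is bounded and meets the
    small tail of [u]. *)
Lemma mertens u v (U : R) (F G : R[i]) :
  (forall n, psum (@normc R \o u) n <= U) ->
  (psum u : nat -> R[i]^o) @ \oo --> (F : R[i]^o) ->
  (psum v : nat -> R[i]^o) @ \oo --> (G : R[i]^o) ->
  (psum (dconv u v) : nat -> R[i]^o) @ \oo --> (F * G : R[i]^o).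
Proof.
move=> uU cF cG; have [B hB] := cvgC_bounded cG.
have B0 : 0 <= B := le_trans (normc_ge0 _) (hB 0%N).
have U0 : 0 <= U by have := uU 0%N; rewrite psum0.
have -> : psum (dconv u v) =
    (fun n => psum (fun k => u k * (psum v (n %/ k) - G)) n + psum u n * G).
  apply/funext => n; rewrite psum_dconv -psumZr -psumD.
  by apply: eq_psum => k _; rewrite mulrBr subrK.
rewrite -[X in _ --> X]add0r.
apply: cvgCD; last exact: cvgC_mulr.
apply/cvgCP => e e0.
pose d := e / (U + B + 1).
have UB : 0 < U + B + 1 by rewrite -addrA ltr_wpDl// ltr_wpDl.
have d0 : 0 < d by rewrite divr_gt0.
have [K hK] := @psum_bounded_tail _ U d d0 (fun k => normc_ge0 (u k)) uU.
move/cvgCP : cG => /(_ d d0)[M hM].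
(* This threshold ensures [n %/ k >= M] for all [k <= K]. *)
exists (K * M.+1)%N => n hn; rewrite subr0.
have Kn : (K <= n)%N by rewrite (leq_trans _ hn)// leq_pmulr.
apply: (@le_trans _ _ (psum (fun k => normc (u k) * normc (psum v (n %/ k) - G))
  n)).
  apply: le_trans (normc_psum _ _) _; apply: ler_psum => k _.
  by rewrite /= normcM.
apply: (@le_trans _ _ (d * (U + B))); last first.
  by rewrite /d -mulrA ler_piMr ?(ltW e0)// ler_pdivrMl// mulr1 lerDl ler01.
have t0 k : 0 <= normc (u k) by exact: normc_ge0.
rewrite /psum (@big_cat_nat _ _ _ K.+1)//= mulrDr lerD//.
  apply: (@le_trans _ _ (psum (@normc R \o u) K * d));
    last by rewrite mulrC ler_wpM2l ?(ltW d0)//; exact: uU.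
  rewrite -psumZr; apply: ler_psum => k /andP[k0 kK] /=.
  rewrite ler_wpM2l//; apply: hM.
  rewrite leq_divRL// (leq_trans _ hn)// (leq_trans _ (leq_mul kK (leqnn _)))//.
  by rewrite mulnC leq_mul.
apply: (@le_trans _ _ ((psum (@normc R \o u) n - psum (@normc R \o u) K) * B));
  last first.
  by rewrite ler_wpM2r// hK.
rewrite {1}/psum (@big_cat_nat _ _ _ K.+1 1 n.+1)//= addrAC subrr add0r
  mulr_suml.
by apply: ler_sum => k _; apply: ler_wpM2l (hB _); exact: t0.
Qed.

End ComplexSequences.

(** * Complex powers of integers and products of Dirichlet series *)

Section NatPow.
Variable R : realType.
Implicit Types (s t : R[i]) (n m : nat).

Lemma normc_natpowC n s : normc (natpowC n s) = n%:R `^ complex.Re s.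
Proof.
rewrite /natpowC normcM normc_real ger0_norm ?powR_ge0//=.
by rewrite cos2Dsin2 sqrtr1 mulr1.
Qed.

Lemma natpowCD n s t : (0 < n)%N ->
  natpowC n (s + t) = natpowC n s * natpowC n t.
Proof.
move=> n0; case: s => a b; case: t => c d; rewrite /natpowC /=.
rewrite powRD ?pnatr_eq0 -?lt0n ?n0 ?implybT//.
rewrite mulrDl cosD sinD; simpc.
by apply/eqP; rewrite eq_complex /=; apply/andP; split; apply/eqP; ring.
Qed.

Lemma natpowCM m n s : (0 < m)%N -> (0 < n)%N ->
  natpowC (m * n) s = natpowC m s * natpowC n s.
Proof.
move=> m0 n0; case: s => a b; rewrite /natpowC /= natrM powRM//.
rewrite lnM ?posrE ?ltr0n// mulrDr cosD sinD; simpc.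
by apply/eqP; rewrite eq_complex /=; apply/andP; split; apply/eqP; ring.
Qed.

Lemma natpowC_real n (x : R) : natpowC n x%:C = (n%:R `^ x)%:C.
Proof. by rewrite /natpowC /= mul0r cos0 sin0 mulr1. Qed.

Lemma dconv_natpowC (a b : nat -> R[i]) s n : (0 < n)%N ->
  dconv a b n * natpowC n s
    = dconv (fun k => a k * natpowC k s) (fun k => b k * natpowC k s) n.
Proof.
move=> n0; rewrite /dconv mulr_suml big_nat_cond [RHS]big_nat_cond.
apply: eq_bigr => k /andP[/andP[k0 kn] kdn].
have -> : natpowC n s = natpowC k s * natpowC (n %/ k) s.
  by rewrite -{1}(divnK kdn) mulnC (natpowCM _ k0)// divn_gt0// dvdn_leq.
rewrite /=; move: (a k) (b _) (natpowC k s) (natpowC _ s) => x y z t.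
exact: mulrACA.
Qed.

Lemma dirichlet_mul (a b : nat -> R[i]) s (W : R) (F G : R[i]) :
  (forall n, psum (fun k => normc (a k) * k%:R `^ (- complex.Re s)) n <= W) ->
  (dirichlet_partial_sum a s : nat -> R[i]^o) @ \oo --> (F : R[i]^o) ->
  (dirichlet_partial_sum b s : nat -> R[i]^o) @ \oo --> (G : R[i]^o) ->
  (dirichlet_partial_sum (dconv a b) s : nat -> R[i]^o) @ \oo --> (F * G :
    R[i]^o).
Proof.
move=> aW cF cG.
have -> : dirichlet_partial_sum (dconv a b) s =
    psum (dconv (fun k => a k * natpowC k (- s)) (fun k => b k * natpowC k (-
      s))).
  apply/funext => n; apply: eq_psum => k /andP[k0 _]; by rewrite dconv_natpowC.
have uW n : psum (@normc R \o (fun k => a k * natpowC k (- s))) n <= W.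
  apply: le_trans (aW n); apply: ler_psum => k _ /=.
  by rewrite normcM normc_natpowC; case: (s).
exact: mertens uW cF cG.
Qed.

End NatPow.

(** * Remainder estimates for the exponential and trigonometric functions *)

Section ExpEstimates.
Variable R : realType.
Implicit Types (x y : R).

Lemma norm_increment_le (f df : R -> R) (B y : R) :
  (forall x, is_derive x 1 f (df x)) ->
  (forall c, `|c| <= `|y| -> `|df c| <= B) -> `|f y - f 0| <= B * `|y|.
Proof.
move=> fdf dfB.
have cf A : {within A, continuous f}.
  apply: continuous_subspaceT => x; apply: differentiable_continuous.
  by apply/derivable1_diffP; have [] := fdf x.
have [y0|y0] := leP 0 y.
  have [c + ->] := MVT_segment y0 (fun x _ => fdf x) (cf _).
  rewrite in_itv/= => /andP[c0 cy]; rewrite subr0 normrM ler_wpM2r// dfB//.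
  by rewrite !ger0_norm// (le_trans c0).
have [c + e] := MVT_segment (ltW y0) (fun x _ => fdf x) (cf _).
rewrite in_itv/= => /andP[yc c0]; rewrite distrC e sub0r normrM normrN.
by rewrite ler_wpM2r// dfB// !ler0_norm ?lerN2 ?(ltW y0).
Qed.

Lemma norm_sin_le y : `|sin y| <= `|y|.
Proof.
have := @norm_increment_le sin cos 1 y _ (fun c _ => cos_max c).
by rewrite sin0 subr0 mul1r; apply=> x; exact: is_derive_sin.
Qed.

Lemma norm_cos_sub1_le y : `|cos y - 1| <= `|y| ^+ 2.
Proof.
rewrite -{1}cos0 expr2; apply: (@norm_increment_le cos (fun x => - sin x)).
by move=> c cy; rewrite normrN (le_trans (norm_sin_le c)).
Qed.

Lemma norm_sin_sub_le y : `|sin y - y| <= `|y| ^+ 2.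
Proof.
have cos_lip (c : R) : `|cos c - 1| <= `|c|.
  have := @norm_increment_le cos (fun x => - sin x) 1 c.
  by rewrite cos0 mul1r; apply => d _; rewrite normrN sin_max.
have := @norm_increment_le (fun x => sin x - x) (fun x => cos x - 1) `|y| y.
rewrite sin0 !subr0 -expr2; apply.
by move=> c; apply: le_trans.
Qed.

(** Only [1 + y <= expR y] is needed, at [x], [-x] and the absolute value; at [-x] it is multiplied
    by [expR x]. *)
Lemma norm_expR_sub1_le x : `|expR x - 1| <= `|x| * expR `|x|.
Proof.
have h1 := expR_ge1Dx x; have h2 := expR_ge1Dx (- x).
have h3 := expR_ge1Dx `|x|.
have [x0|x0] := leP 0 x.
  rewrite !ger0_norm//; last by move: h1; lra.
  move: h2 => /(ler_wpM2r (expR_ge0 x)); rewrite -expRD addNr expR0; lra.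
rewrite ltr0_norm ?subr_lt0 ?expR_lt1// opprB.
apply: (@le_trans _ _ `|x|); first by rewrite ltr0_norm//; lra.
by rewrite ler_peMr//; apply: le_trans h3; rewrite lerDl.
Qed.

Lemma norm_expR_sub1D_le x : `|expR x - 1 - x| <= `|x| ^+ 2 * expR `|x|.
Proof.
have h1 := expR_ge1Dx x; have h2 := expR_ge1Dx (- x).
rewrite ger0_norm; last by lra.
apply: (@le_trans _ _ (`|x| * `|expR x - 1|)); last first.
  by rewrite expr2 -mulrA ler_wpM2l// norm_expR_sub1_le.
rewrite -normrM; apply: le_trans (ler_norm _).
move: h2 => /(ler_wpM2r (expR_ge0 x)); rewrite -expRD addNr expR0; lra.
Qed.

(** Explicit in [n], so that it can be summed over a Dirichlet series. The constant 4 counts two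
    pieces of the real part and two of the imaginary part, each at most [r^2 * expR r]. *)
Lemma normc_natpowC_taylor (n : nat) (w : R[i]) : (0 < n)%N ->
  normc (natpowC n w - 1 - w * (ln n%:R)%:C)
    <= 4 * (normc w * ln n%:R) ^+ 2 * n%:R `^ normc w.
Proof.
move=> n0; have nR : 0 < n%:R :> R by rewrite ltr0n.
have l0 : 0 <= ln n%:R :> R by rewrite ln_ge0// ler1n.
have hre := ler_absRe_normc w; have him := ler_absIm_normc w.
set r := normc w * ln n%:R.
have r0 : 0 <= r by rewrite mulr_ge0 ?normc_ge0.
have -> : n%:R `^ normc w = expR r by rewrite /powR gt_eqF.
pose x := complex.Re w * ln n%:R; pose y := complex.Im w * ln n%:R.
have xr : `|x| <= r by rewrite normrM (ger0_norm l0) ler_wpM2r.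
have yr : `|y| <= r by rewrite normrM (ger0_norm l0) ler_wpM2r.
have -> : natpowC n w - 1 - w * (ln n%:R)%:C =
    (expR x * cos y - 1 - x) +i* (expR x * sin y - y).
  rewrite /natpowC /powR gt_eqF// -/x -/y /x /y; case: (w) => a b /=.
  by simpc.
apply: le_trans (normc_le_ReIm _) _; rewrite /=.
have e1 : 1 <= expR r by apply: le_trans (expR_ge1Dx r); rewrite lerDl.
have ex : expR `|x| <= expR r by rewrite ler_expR.
have ex' : expR x <= expR r by rewrite ler_expR (le_trans (ler_norm _)).
have x2 : `|x| ^+ 2 <= r ^+ 2 by rewrite ler_pXn2r ?nnegrE.
have y2 : `|y| ^+ 2 <= r ^+ 2 by rewrite ler_pXn2r ?nnegrE.
have r2 : 0 <= r ^+ 2 by rewrite exprn_ge0.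
have -> : 4 * r ^+ 2 * expR r = (r ^+ 2 * expR r + r ^+ 2 * expR r)
    + (r * expR r * r + r ^+ 2 * expR r) by ring.
apply: lerD.
  have -> : expR x * cos y - 1 - x = expR x * (cos y - 1) + (expR x - 1 - x) by
    ring.
  apply: le_trans (ler_normD _ _) _; apply: lerD.
    rewrite normrM mulrC (ger0_norm (expR_ge0 _)) ler_pM ?expR_ge0//.
    exact: le_trans (norm_cos_sub1_le y) y2.
  by apply: le_trans (norm_expR_sub1D_le x) _;
    rewrite ler_pM ?expR_ge0 ?sqr_ge0.
have -> : expR x * sin y - y = (expR x - 1) * sin y + (sin y - y) by ring.
apply: le_trans (ler_normD _ _) _; apply: lerD.
  rewrite normrM ler_pM//; last exact: le_trans (norm_sin_le y) yr.
  by apply: le_trans (norm_expR_sub1_le x) _; rewrite ler_pM ?expR_ge0.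
apply: le_trans (norm_sin_sub_le y) _.
by rewrite -[leLHS]mulr1 ler_pM ?sqr_ge0.
Qed.

Lemma ln_le_powR (n : nat) (eps : R) : 0 < eps -> (0 < n)%N ->
  ln n%:R <= eps^-1 * n%:R `^ eps :> R.
Proof.
move=> e0 n0; rewrite ler_pdivlMl// -ln_powR ltW// ln_sublinear//.
by rewrite powR_gt0// ltr0n.
Qed.

End ExpEstimates.

(** * Existence and analyticity of the sum *)

Section DirichletSeriesTheory.
Variable R : realType.
Implicit Types (a e r : nat -> R[i]) (s h : R[i]).

Lemma dirichlet_sum_exists a (theta : R) :
  (forall sigma, theta < sigma -> exists W : R, forall n,
     psum (fun k => normc (a k) * k%:R `^ (- sigma)) n <= W) ->
  exists f, dirichlet_sum_on (half_plane theta) a f.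
Proof.
move=> aW.
have ex s : exists l, half_plane theta s ->
    (dirichlet_partial_sum a s : nat -> R[i]^o) @ \oo --> (l : R[i]^o).
  (* Off the half-plane the value of the sum is arbitrary. *)
  have [hs|ns] := pselect (half_plane theta s); last by exists 0.
  have [W hW] := aW _ hs.
  have [|l hl] := @cvgC_psum R (fun k => a k * natpowC k (- s)) W.
    move=> n; apply: le_trans (hW n); apply: ler_psum => k _ /=.
    by rewrite normcM normc_natpowC; case: (s).
  by exists l.
by have [f hf] := choice ex; exists f => s; exact: hf.
Qed.

(** The candidate derivative is [- L], with [L] the sum of [e k * ln k * k^(-s)]. Summing the Taylor
    remainders shows that [f (s + h) - f s + L * h] is at most a constant times the square of
    [normc h]. *)
Lemma analytic_dirichlet e (theta W : R) f :
  (forall n, psum (fun k => normc (e k) * k%:R `^ (- theta)) n <= W) ->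
  dirichlet_sum_on (half_plane theta) e f -> analytic_on (half_plane theta) f.
Proof.
(* A third of the distance to the boundary: two thirds absorb the squared logarithm, one third the
   factor [k^(normc h)]. *)
move=> eW ef s hs; pose d := (complex.Re s - theta) / 3.
have d0 : 0 < d by rewrite divr_gt0// subr_gt0.
have sE : complex.Re s = theta + 3 * d by rewrite /d; field.
have W0 : 0 <= W by have := eW 0%N; rewrite psum0.
have powle (k : nat) (x y : R) : (0 < k)%N -> x <= y -> k%:R `^ x <= k%:R `^ y
  :> R.
  by move=> k0 xy; rewrite ler_powR// ler1n.
pose u k := e k * natpowC k (- s).
have normu k : normc (u k) = normc (e k) * k%:R `^ (- complex.Re s).
  by rewrite normcM normc_natpowC; case: (s).
pose t k := u k * (ln k%:R)%:C.
have lnE (k : nat) : (0 < k)%N -> normc (ln (k%:R : R))%:C = ln k%:R.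
  by move=> k0; rewrite normc_real ger0_norm// ln_ge0// ler1n.
have [L cL] : exists L, (psum t : nat -> R[i]^o) @ \oo --> (L : R[i]^o).
  apply: (@cvgC_psum R t (W * d^-1)) => n.
  apply: le_trans (ler_wpM2r _ (eW n)); last by rewrite invr_ge0 ltW.
  rewrite -psumZr; apply: ler_psum => k /andP[k0 _] /=.
  rewrite /t normcM normu lnE// -!mulrA ler_wpM2l ?normc_ge0//.
  apply: (@le_trans _ _ (k%:R `^ (- complex.Re s) * (d^-1 * k%:R `^ d))).
    by rewrite ler_wpM2l ?powR_ge0// ln_le_powR.
  rewrite mulrCA mulrC ler_wpM2r ?invr_ge0 ?(ltW d0)//.
  rewrite -powRD ?pnatr_eq0 -?lt0n ?k0 ?implybT//.
  by apply: powle => //; rewrite sE; lra.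
pose M := 4 * (d^-1) ^+ 2 * W.
have dV0 : 0 <= d^-1 by rewrite invr_ge0 ltW.
have M0 : 0 <= M by rewrite !mulr_ge0.
have est h : normc h <= d ->
    normc (f (h + s) + (f s * (- 1) + L * h)) <= M * normc h ^+ 2.
  move=> hd; have := ler_absRe_normc h; rewrite ler_norml => /andP[hre _].
  have hhs : half_plane theta (h + s).
    rewrite /half_plane /=; have -> : complex.Re (h + s) = complex.Re h +
      complex.Re s.
      by case: (h) (s) => ? ? [].
    by rewrite sE; lra.
  pose z n := dirichlet_partial_sum e (h + s) n
    + (dirichlet_partial_sum e s n * (- 1) + psum t n * h).
  have cz := cvgCD (ef _ hhs) (cvgCD (cvgC_mulr (c := - 1) (ef _ hs)) (cvgC_mulr
    (c := h) cL)).
  apply: (cvgC_normc_le cz) => n; rewrite -/(z n).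
  have -> : z n = psum (fun k => u k * (natpowC k (- h) - 1 - (- h) * (ln
    k%:R)%:C)) n.
    rewrite /z /dirichlet_partial_sum -/(psum _ n) -/(psum _ n) -!psumZr
      -!psumD.
    apply: eq_psum => k /andP[k0 _]; rewrite opprD natpowCD// /t /u.
    move: (natpowC k (- h)) (natpowC k (- s)) => x y; ring.
  apply: le_trans (normc_psum _ _) _.
  have c0 : 0 <= normc h ^+ 2 * (4 * d^-1 ^+ 2) by rewrite !mulr_ge0 ?normc_ge0.
  apply: (@le_trans _ _ (normc h ^+ 2 * (4 * d^-1 ^+ 2) * psum (fun k => normc
    (e k) * k%:R `^ (- theta)) n)); last first.
    rewrite [leRHS](_ : _ = normc h ^+ 2 * (4 * d^-1 ^+ 2) * W) ?ler_wpM2l//.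
    by rewrite /M; ring.
  rewrite -psumZl; apply: ler_psum => k /andP[k0 _] /=.
  rewrite normcM normu.
  have := normc_natpowC_taylor (- h) k0; rewrite normcN => taylor.
  apply: le_trans (ler_wpM2l _ taylor) _.
    by rewrite mulr_ge0 ?normc_ge0 ?powR_ge0.
  set l := ln k%:R; set K : R := k%:R.
  have l0 : 0 <= l by rewrite ln_ge0// ler1n.
  have lK : l <= d^-1 * K `^ d by exact: ln_le_powR.
  have l2 : l ^+ 2 <= d^-1 ^+ 2 * (K `^ d * K `^ d).
    by rewrite -expr2 -exprMn ler_pXn2r ?nnegrE// mulr_ge0 ?invr_ge0 ?powR_ge0//
      ltW.
  have KK : K `^ (- complex.Re s) * (K `^ d * K `^ d * K `^ normc h) <= K `^ (-
    theta).
    rewrite -!powRD ?pnatr_eq0 -?lt0n ?k0 ?implybT//.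
    by apply: powle => //; rewrite sE; lra.
  rewrite exprMn.
  apply: (@le_trans _ _ (normc (e k) * K `^ (- complex.Re s) *
      (4 * (normc h ^+ 2 * (d^-1 ^+ 2 * (K `^ d * K `^ d))) * K `^ normc h))).
    rewrite ler_wpM2l ?mulr_ge0 ?normc_ge0 ?powR_ge0//.
    by rewrite ler_wpM2r ?powR_ge0// ler_pM2l// ler_wpM2l ?sqr_ge0.
  apply: (@le_trans _ _ (normc h ^+ 2 * (4 * d^-1 ^+ 2) * (normc (e k) *
     (K `^ (- complex.Re s) * (K `^ d * K `^ d * K `^ normc h))))).
    rewrite le_eqVlt; apply/orP; left; apply/eqP; ring.
  by rewrite ler_wpM2l// ler_wpM2l ?normc_ge0.
apply/cvg_ex; exists (- L : R[i]^o); apply/cvgrPdist_le => eps.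
rewrite ltcE /= => /andP[/eqP epsi eps0].
have M1 : 0 < M + 1 by rewrite ltr_wpDl.
pose rho := Num.min d (complex.Re eps / (M + 1)).
have rho0 : 0 < rho by rewrite lt_min d0 divr_gt0.
exists (rho%:C); first by rewrite /= ltcR.
move=> h /=; rewrite sub0r normrN norm_normc ltcR => hrho h0.
have hd : normc h <= d by apply: le_trans (ltW hrho) _; rewrite ge_min lexx.
have he : normc h <= complex.Re eps / (M + 1).
  by apply: le_trans (ltW hrho) _; rewrite ge_min lexx orbT.
have hN0 : h != 0 :> R[i] by [].
have nh : 0 < normc h.
  rewrite lt_neqAle normc_ge0 andbT eq_sym; apply/eqP => /eq0_normc h00.
  by rewrite h00 eqxx in hN0.
have key : normc (- L - h^-1 * (f (h * 1 + s) - f s)) <= complex.Re eps.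
  have -> : - L - h^-1 * (f (h * 1 + s) - f s) =
      - (h^-1 * (f (h + s) + (f s * (- 1) + L * h))).
    by rewrite mulr1; field.
  rewrite normcN normcM normcV.
  apply: le_trans (ler_wpM2l _ (est h hd)) _; first by rewrite invr_ge0 ltW.
  rewrite expr2 mulrCA mulKf ?gt_eqF//.
  apply: le_trans (ler_wpM2l M0 he) _.
  by rewrite mulrCA ler_piMr ?(ltW eps0)// ler_pdivrMr// mul1r lerDl ler01.
by rewrite norm_normc lecE /= epsi eqxx; exact: key.
Qed.

End DirichletSeriesTheory.

(** * The sequence spaces *)

Section EReal.
Variable R : realType.

Lemma nneseries_lty (u : nat -> \bar R) : (forall n, 0 <= u n)%E ->
  (\sum_(1 <= n <oo) u n < +oo)%E <->
  exists B : R, forall n, (\sum_(1 <= k < n.+1) u k <= B%:E)%E.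
Proof.
move=> u0; split=> [fin|[B hB]].
  exists (fine (\sum_(1 <= n <oo) u n)%E) => n.
  rewrite fineK; first by apply: nneseries_lim_ge => k _ _; exact: u0.
  by rewrite ge0_fin_numE// nneseries_ge0.
apply: (@le_lt_trans _ _ B%:E); last exact: ltry.
apply: lime_le; first by apply: is_cvg_nneseries => k _ _; exact: u0.
apply: nearW => -[|n]; last exact: hB.
by rewrite big_geq//; have := hB 0%N; rewrite big_geq.
Qed.

Lemma poweR_lty_iff (x : \bar R) (r : R) : 0 < r ->
  (poweR x r < +oo)%E <-> (x < +oo)%E.
Proof.
move=> r0; split; last exact: poweR_lty.
by rewrite !ltey; apply: contra_neq => ->; rewrite poweRyr// gt_eqF.
Qed.

(** [d] is the least decreasing majorant. Its finiteness is read off from the series, which starts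
    at 1, whence the restrictions to positive indices. *)
Lemma sup_series_dominant (t : nat -> R) : (forall k, 0 <= t k) ->
  (\sum_(1 <= n <oo) ereal_sup [set (t k)%:E | k in [set k | (n <= k)%N]]
    < +oo)%E ->
  exists d (D : R), [/\ forall k, 0 <= d k,
    forall k m, (0 < k <= m)%N -> d m <= d k,
    forall k, (0 < k)%N -> t k <= d k &
    forall n, psum d n <= D].
Proof.
move=> t0; pose s n := ereal_sup [set (t k)%:E | k in [set k | (n <= k)%N]].
have ts n : ((t n)%:E <= s n)%E by apply: ereal_sup_ubound; exists n => /=.
have s0 n : (0 <= s n)%E by apply: le_trans (ts n); rewrite lee_fin.
move=> /(nneseries_lty s0)[D hD].
have sfin n : (0 < n)%N -> s n \is a fin_num.
  case: n => // n _; rewrite ge0_fin_numE//; apply: le_lt_trans (ltry D).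
  apply: le_trans (hD n.+1); rewrite big_nat_recr//= leeDr// sume_ge0//.
exists (fine \o s), D; split=> /=.
- by move=> k; rewrite fine_ge0.
- move=> k m /andP[k0 km]; apply: fine_le; rewrite ?sfin ?(leq_trans k0)//.
  apply: ereal_sup_le => _ [i /= mi <-]; exists i => //=; exact: leq_trans mi.
- by move=> k k0; rewrite -lee_fin fineK ?sfin.
- move=> n; rewrite -lee_fin; apply: le_trans (hD n).
  rewrite /psum -sumEFin le_eqVlt; apply/orP; left; apply/eqP.
  by apply: eq_big_nat => k /andP[k0 _]; rewrite /= fineK ?sfin.
Qed.

(** A partial sum involves only [M] suprema, each approached by a selected term. *)
Lemma sup_series_selection (t : nat -> R) (D : R) : (forall k, 0 <= t k) ->
  (forall (kappa : nat -> nat) M, (forall n, (n <= kappa n)%N) ->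
    psum (fun n => t (kappa n)) M <= D) ->
  (\sum_(1 <= n <oo) ereal_sup [set (t k)%:E | k in [set k | (n <= k)%N]]
    < +oo)%E.
Proof.
move=> t0 hD; pose s n := ereal_sup [set (t k)%:E | k in [set k | (n <= k)%N]].
have ts n : ((t n)%:E <= s n)%E by apply: ereal_sup_ubound; exists n => /=.
have s0 n : (0 <= s n)%E by apply: le_trans (ts n); rewrite lee_fin.
have sfin n : (0 < n)%N -> s n \is a fin_num.
  move=> n0; rewrite ge0_fin_numE//; apply: le_lt_trans (ltry D).
  apply: ge_ereal_sup => _ [k /= nk <-]; rewrite lee_fin.
  (* The selection [maxn k] takes the value [k] at [n], so each single term beyond [n] is at most
     [D] and the supremum is finite. *)
  apply: le_trans (hD (maxn k) n _); last by move=> m; exact: leq_maxr.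
  rewrite -{1}(maxn_idPl nk).
  by apply: (@ler_term_psum _ (fun n => t (maxn k n))) => //; rewrite n0 leqnn.
apply/(nneseries_lty s0); exists D => M.
rewrite (eq_big_nat _ _ (F2 := fun n => (fine (s n))%:E)); last first.
  by move=> k /andP[k0 _]; rewrite fineK ?sfin.
rewrite sumEFin lee_fin -/(psum (fun n => fine (s n)) M).
apply/ler_addgt0Pr => e e0.
(* The [M] losses of [d] add up to at most [e]. *)
pose d := e / M.+1%:R; have d0 : 0 < d by rewrite divr_gt0.
have sel n : exists k, (n <= k)%N /\ ((0 < n)%N -> fine (s n) - d <= t k).
  have [->|n0] := posnP n; first by exists 0%N.
  have [_ [k /= nk <-] hk] := ub_ereal_sup_adherent d0 (sfin n n0).
  exists k; split => // _; rewrite -lee_fin ltW//.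
  by rewrite EFinB fineK ?sfin.
have [kappa hk] := choice sel.
apply: (@le_trans _ _ (psum (fun n => t (kappa n) + d) M)).
  by apply: ler_psum => n /andP[n0 _]; rewrite -lerBlDr; have [_ ->] := hk n.
rewrite psumD lerD//; first by apply: hD => n; have [] := hk n.
rewrite /psum sumr_const_nat subSS subn0 -[leLHS]mulr_natr /d -mulrA.
by rewrite ler_piMr ?(ltW e0)// ler_pdivrMl// mulr1 ler_nat.
Qed.

End EReal.

(** * Translation of the norms into bounds on finite sums *)

Section CesSpace.
Variables (R : realType) (p q : R).
Hypotheses (hp : 1 < p) (hpq : p^-1 + q^-1 = 1).
Implicit Types (a b e : nat -> R[i]).

Let q1 : 1 < q := conjugate_gt1 hp hpq.
Let p0 : 0 < p := lt_trans ltr01 hp.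
Let q0 : 0 < q := lt_trans ltr01 q1.

Lemma ces_boundedP a :
  ces p a <-> exists B : R, ces_bounded p (fun k => normc (a k)) B.
Proof.
rewrite /ces /= /ces_norm.
have pV0 : 0 < p^-1 by rewrite invr_gt0.
rewrite (poweR_lty_iff _ pV0) nneseries_lty; last first.
  by move=> n; rewrite lee_fin powR_ge0.
by split=> -[B hB]; exists B => n; have := hB n; rewrite sumEFin lee_fin.
Qed.

Lemma weighted_powR (x : R) (k : nat) : 0 <= x ->
  (x * k%:R `^ (- q^-1)) `^ q = x `^ q / k%:R.
Proof.
by move=> x0; rewrite powRM ?powR_ge0// -powRrM mulNr mulVf ?gt_eqF// powR_inv1.
Qed.

Lemma d_space_weighted b :
  d_space q (fun n => b n * (n%:R `^ (- q^-1))%:C) <->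
  (\sum_(1 <= n <oo) ereal_sup [set (normc (b k) `^ q / k%:R)%:E
     | k in [set k | (n <= k)%N]] < +oo)%E.
Proof.
rewrite /d_space /= /d_norm.
have qV0 : 0 < q^-1 by rewrite invr_gt0.
rewrite (poweR_lty_iff _ qV0).
have -> // : (\sum_(1 <= n <oo) ereal_sup
    [set (normc (b k * (k%:R `^ (- q^-1))%:C) `^ q)%:E | k in [set k | (n <=
      k)%N]]
  = \sum_(1 <= n <oo) ereal_sup
    [set (normc (b k) `^ q / k%:R)%:E | k in [set k | (n <= k)%N]])%E.
rewrite eseries_cond [RHS]eseries_cond.
apply: eq_eseriesr => n n1; congr ereal_sup.
apply: eq_imagel => k /= nk; congr (_%:E).
by rewrite normcM normc_real ger0_norm ?powR_ge0// weighted_powR// normc_ge0.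
Qed.

(** Duality with the decreasing sequence [k^(-sigma)], whose [q]-th powers are summable because
    [sigma * q > 1]. *)
Lemma ces_abs_summable (a : nat -> R) (B sigma : R) : (forall k, 0 <= a k) ->
  ces_bounded p a B -> q^-1 < sigma ->
  exists W : R, forall n, psum (fun k => a k * k%:R `^ (- sigma)) n <= W.
Proof.
move=> a0 aB qs.
have sq1 : 1 < sigma * q by rewrite -ltr_pdivrMr// mul1r.
have [Z Z0 hZ] := zeta_bounded sq1.
exists (2 * (B / p + 2 * Z / q)) => n.
apply: (psum_dual hp hpq) => //.
- move=> k m /andP[k0 km]; rewrite !powRN lef_pV2 ?posrE ?powR_gt0 ?ltr0n
  ?(leq_trans k0)//.
  apply: ge0_ler_powR; rewrite ?nnegrE ?ler0n ?ler_nat// ltW// (lt_trans _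
    qs)//.
  by rewrite invr_gt0.
- move=> m; apply: le_trans (hZ m); apply: ler_psum => k _.
  by rewrite -powRrM mulNr.
Qed.

End CesSpace.

(** * Uniqueness of Dirichlet coefficients *)

Section Uniqueness.
Variable R : realType.

(** Once the earlier coefficients vanish, the [n]-th term is balanced by the tail. At [sigma0 + j]
    the tail is at most [W * (n+1)^(-j)], so the [n]-th term at [sigma0] is at most
    [W * (n/(n+1))^j], which tends to 0 with [j]. *)
Lemma dirichlet_coef_unique (r : nat -> R[i]) (sigma0 W : R) :
  (forall n, psum (fun k => normc (r k) * k%:R `^ (- sigma0)) n <= W) ->
  (forall sigma, sigma0 <= sigma ->
    (dirichlet_partial_sum r sigma%:C : nat -> R[i]^o) @ \oo --> (0 : R[i]^o))
      ->
  forall n, (0 < n)%N -> r n = 0.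
Proof.
move=> rW r_0; elim/ltn_ind => n IH n0; apply: eq0_normc.
have W0 : 0 <= W by have := rW 0%N; rewrite psum0.
have nR : 0 < n%:R :> R by rewrite ltr0n.
pose rho : R := n%:R / n.+1%:R.
have rho0 : 0 < rho by rewrite divr_gt0.
have rho1 : rho < 1 by rewrite ltr_pdivrMr// mul1r ltr_nat.
pose x := normc (r n) * n%:R `^ (- sigma0).
have bound j : x <= W * rho ^+ j.
  pose sigma := sigma0 + j%:R.
  have sE (k : nat) : (0 < k)%N -> k%:R `^ (- sigma) = k%:R `^ (- sigma0) *
    (k%:R^-1) ^+ j :> R.
    move=> k0; rewrite /sigma opprD powRD ?pnatr_eq0 -?lt0n ?k0 ?implybT//.
    by rewrite powR_invn ?ler0n// exprVn.
  suff : x * (n%:R^-1) ^+ j <= W * (n.+1%:R^-1) ^+ j.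
    rewrite exprVn ler_pdivrMr ?exprn_gt0// -mulrA [_^-1 ^+ j * _]mulrC.
    by rewrite exprVn -expr_div_n.
  apply/ler_addgt0Pr => e e0.
  have s0s : sigma0 <= sigma by rewrite lerDl.
  have /cvgCP/(_ e e0)[N hN] := r_0 sigma s0s.
  pose m := maxn N n.
  have := hN m (leq_maxl _ _); rewrite subr0 => Pm.
  have nm : (n <= m)%N := leq_maxr _ _.
  pose u k := r k * natpowC k (- sigma%:C).
  have normu k : (0 < k)%N -> normc (u k) = normc (r k) * k%:R `^ (- sigma0) *
    (k%:R^-1) ^+ j.
    by move=> k0; rewrite normcM normc_natpowC /= sE// mulrA.
  have split_sum : psum u m = u n + \sum_(n.+1 <= k < m.+1) u k.
    rewrite /psum (@big_cat_nat _ _ _ n)//=; last exact: leqW.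
    rewrite big_nat big1 ?add0r; last by move=> k /andP[k0 kn];
      rewrite /u IH// mul0r.
    by rewrite big_ltn.
  have -> : x * n%:R^-1 ^+ j = normc (u n) by rewrite normu.
  have -> : u n = psum u m - \sum_(n.+1 <= k < m.+1) u k by rewrite split_sum
    addrK.
  apply: le_trans (le_normcD _ _) _; rewrite normcN addrC lerD//.
  apply: (@le_trans _ _ (\sum_(n.+1 <= k < m.+1) normc (u k))).
    elim/big_ind2 : _ => //; first by rewrite normc0.
    by move=> y1 x1 y2 x2 h1 h2; apply: le_trans (le_normcD _ _) _;
      rewrite lerD.
  apply: (@le_trans _ _ (\sum_(n.+1 <= k < m.+1) (normc (r k) * k%:R `^ (-
    sigma0)) * n.+1%:R^-1 ^+ j)).
    apply: ler_sum_nat => k /andP[nk km]; have k0 : (0 < k)%N by rewrite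
      (leq_trans _ nk).
    rewrite normu// ler_wpM2l ?mulr_ge0 ?normc_ge0 ?powR_ge0//.
    by rewrite lerXn2r ?nnegrE ?invr_ge0// lef_pV2 ?posrE ?ltr0n// ler_nat.
  rewrite -mulr_suml ler_wpM2r ?exprn_ge0 ?invr_ge0//.
  apply: le_trans (rW m); rewrite [leRHS](@big_cat_nat _ _ _ n.+1)//=.
  by rewrite lerDr sumr_ge0// => k _; rewrite mulr_ge0 ?normc_ge0 ?powR_ge0.
have x0 : x <= 0.
  have c0 : (fun j => W * rho ^+ j) @ \oo --> 0.
    rewrite -[X in _ --> X](mulr0 W); apply: cvgMl_tmp; apply: cvg_expr.
    by rewrite ger0_norm// ltW.
  by apply: (cvgr_to_ge c0); apply: nearW => j; exact: bound.
apply/eqP; rewrite eq_le normc_ge0 andbT.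
by move: x0; rewrite /x pmulr_lle0// powR_gt0.
Qed.

End Uniqueness.

(** * Multipliers *)

Section Multipliers.
Variables (R : realType) (p q : R).
Hypotheses (hp : 1 < p) (hpq : p^-1 + q^-1 = 1).
Implicit Types (a b e : nat -> R[i]).

Let q1 : 1 < q := conjugate_gt1 hp hpq.
Let p0 : 0 < p := lt_trans ltr01 hp.
Let q0 : 0 < q := lt_trans ltr01 q1.

Lemma normc_dconv_le e a n :
  normc (dconv e a n) <= dconv (fun k => normc (e k)) (fun k => normc (a k)) n.
Proof.
rewrite /dconv; elim/big_ind2 : _ => //; first by rewrite normc0.
- by move=> y1 x1 y2 x2 h1 h2; apply: le_trans (le_normcD _ _) _; rewrite lerD.
- by move=> k _; rewrite normcM.
Qed.

Lemma psum_weight_mono (u : nat -> R) (s t : R) n : (forall k,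
  0 <= u k) -> s <= t ->
  psum (fun k => u k * k%:R `^ (- t)) n <= psum (fun k => u k * k%:R `^ (- s))
    n.
Proof.
move=> u0 st; apply: ler_psum => k /andP[k0 _].
by rewrite ler_wpM2l// ler_powR ?lerN2// ler1n.
Qed.

(** Summability at the boundary point [1/q] bounds convolution by [e] on the sequence space; inside
    the half-plane it gives the absolute convergence that Mertens' theorem asks for. *)
Lemma multiplier_of_summable e (W : R) : 0 < W ->
  (forall n, psum (fun k => normc (e k) * k%:R `^ (- q^-1)) n <= W) ->
  dirichlet_multiplier p q e.
Proof.
move=> W0 eW; have e0 k : 0 <= normc (e k) by exact: normc_ge0.
have eWs sigma : q^-1 < sigma ->
    forall n, psum (fun k => normc (e k) * k%:R `^ (- sigma)) n <= W.
  by move=> qs n; apply: le_trans (psum_weight_mono n e0 (ltW qs)) (eW n).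
have [|f hf] := @dirichlet_sum_exists R e q^-1.
  by move=> sigma qs; exists W; exact: eWs.
exists f; first exact: hf.
split; first exact: analytic_dirichlet eW hf.
move=> g [a /(ces_boundedP hp)[B aB] ag]; exists (dconv e a).
  apply/(ces_boundedP hp); exists (W `^ p * B) => n.
  apply: le_trans (ces_bounded_dconv hp hpq W0 e0 (fun k => normc_ge0 (a k)) eW
    aB n).
  by apply: ler_psum_ces => // k; rewrite normc_ge0 normc_dconv_le.
move=> s hs; exact: dirichlet_mul (eWs _ hs) (hf s hs) (ag s hs).
Qed.

Lemma multiplier_sufficient b :
  d_space q (fun n => b n * (n%:R `^ (- q^-1))%:C) ->
  forall a, ces p a -> dirichlet_multiplier p q (fun n => a n * b n).
Proof.
move=> /(d_space_weighted hp hpq) hb a /(ces_boundedP hp)[B aB].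
have t0 k : 0 <= normc (b k) `^ q / k%:R by rewrite divr_ge0 ?powR_ge0.
have [d [D [d0 dd td dD]]] := sup_series_dominant t0 hb.
have D0 : 0 <= D by have := dD 0%N; rewrite psum0.
have B0 : 0 <= B := ces_bounded_ge0 aB.
(* A decreasing majorant of the weighted [b], with summable [q]-th powers, as the duality inequality
   requires. *)
pose c k := d k `^ q^-1.
have bc k : (0 < k)%N -> normc (b k) * k%:R `^ (- q^-1) <= c k.
  move=> k0; have x0 : 0 <= normc (b k) * k%:R `^ (- q^-1).
    by rewrite mulr_ge0 ?normc_ge0 ?powR_ge0.
  have -> : normc (b k) * k%:R `^ (- q^-1)
      = (normc (b k) `^ q / k%:R) `^ q^-1.
    by rewrite -(weighted_powR hp hpq)// ?normc_ge0// -powRrM mulfV ?gt_eqF//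
      powRr1.
  by apply: ge0_ler_powR; rewrite ?nnegrE ?invr_ge0 ?(ltW q0)// td.
pose W := 2 * (B / p + 2 * D / q) + 1.
have W0 : 0 < W.
  by rewrite ltr_wpDl// mulr_ge0// addr_ge0// divr_ge0 ?(ltW p0) ?(ltW q0)//
    mulr_ge0.
apply: (multiplier_of_summable W0) => n.
apply: (@le_trans _ _ (psum (fun k => normc (a k) * c k) n)).
  apply: ler_psum => k /andP[k0 _].
  by rewrite normcM -mulrA ler_wpM2l ?normc_ge0// bc.
apply: le_trans (_ : 2 * (B / p + 2 * D / q) <= W); last by rewrite lerDl.
apply: (psum_dual hp hpq) => //.
- by move=> k; exact: normc_ge0.
- by move=> k; exact: powR_ge0.
- move=> k m km; apply: ge0_ler_powR; rewrite ?nnegrE ?invr_ge0 ?(ltW q0)//.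
  exact: dd.
- move=> m; apply: le_trans (dD m); apply: ler_psum => k _.
  by rewrite -powRrM mulVf ?gt_eqF// powRr1.
Qed.

(** A multiplier's series is only known to converge; for nonnegative coefficients at a real point
    this is absolute convergence. *)
Lemma nonneg_summable (u : nat -> R) (sigma : R) (l : R[i]) :
  (forall k, 0 <= u k) ->
  (dirichlet_partial_sum (fun k => (u k)%:C) sigma%:C : nat -> R[i]^o) @ \oo
    --> (l : R[i]^o) ->
  exists W : R, forall n, psum (fun k => u k * k%:R `^ (- sigma)) n <= W.
Proof.
move=> u0 cl; have [B hB] := cvgC_bounded cl.
exists (B + normc l) => n.
have psumE : dirichlet_partial_sum (fun k => (u k)%:C) sigma%:C n =
    (psum (fun k => u k * k%:R `^ (- sigma)) n)%:C.
  rewrite /psum rmorph_sum; apply: eq_bigr => k _.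
  by rewrite -rmorphN natpowC_real -rmorphM.
have := hB n; rewrite psumE => h.
have -> : psum (fun k => u k * k%:R `^ (- sigma)) n =
    normc (psum (fun k => u k * k%:R `^ (- sigma)) n)%:C.
  by rewrite normc_real ger0_norm// psum_ge0// => k; rewrite mulr_ge0 ?powR_ge0.
move: h; set x := (psum _ n)%:C => h.
rewrite -[x](subrK l); apply: le_trans (le_normcD _ _) _.
by rewrite lerD2r.
Qed.

Lemma dconv_summable (u v : nat -> R) (sigma U V : R) :
  (forall k, 0 <= u k) -> (forall k, 0 <= v k) ->
  (forall n, psum (fun k => u k * k%:R `^ (- sigma)) n <= U) ->
  (forall n, psum (fun k => v k * k%:R `^ (- sigma)) n <= V) ->
  forall n, psum (fun k => dconv u v k * k%:R `^ (- sigma)) n <= U * V.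
Proof.
move=> u0 v0 uU vV n.
have u0' k : 0 <= u k * k%:R `^ (- sigma) by rewrite mulr_ge0 ?powR_ge0.
have V0 : 0 <= V by have := vV 0%N; rewrite psum0.
have -> : psum (fun k => dconv u v k * k%:R `^ (- sigma)) n =
    psum (dconv (fun k => u k * k%:R `^ (- sigma)) (fun k => v k * k%:R `^ (-
      sigma))) n.
  apply: eq_psum => m /andP[m0 _]; rewrite /dconv mulr_suml.
  apply: eq_bigr => k km.
  have -> : m%:R `^ (- sigma) = k%:R `^ (- sigma) * (m %/ k)%:R `^ (- sigma) :>
    R.
    by rewrite -powRM// -natrM mulnC divnK.
  by rewrite mulrACA.
rewrite psum_dconv; apply: (@le_trans _ _ (psum (fun k => u k * k%:R `^ (-
  sigma) * V) n)).
  by apply: ler_psum => k _; rewrite ler_wpM2l.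
by rewrite psumZr ler_wpM2r.
Qed.

(** The phases of [b] are moved into [a], so that the multiplier has coefficients [u >= 0]. Its
    product with the series of [g] has coefficients [h] of finite norm, and also coefficients
    [dconv u g]; uniqueness identifies them. *)
Lemma multiplier_conv_bounded b :
  (forall a, ces p a -> dirichlet_multiplier p q (fun n => a n * b n)) ->
  forall (a g : nat -> R) (A B : R),
    (forall k, 0 <= a k) -> (forall k, 0 <= g k) ->
    ces_bounded p a A -> ces_bounded p g B ->
    exists C : R, ces_bounded p (dconv (fun k => a k * normc (b k)) g) C.
Proof.
move=> mult a g A B a0 g0 aA gB.
pose u k := a k * normc (b k).
have u0 k : 0 <= u k by rewrite mulr_ge0 ?normc_ge0.
(* Division by zero gives 0, so [a'] vanishes where [b] does; elsewhere its modulus is [a k]. *)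
pose a' k := (u k)%:C / b k.
have a'b : (fun n => a' n * b n) = (fun n => (u n)%:C).
  apply/funext => n; rewrite /a'; have [bn|bn] := eqVneq (b n) 0.
    by rewrite bn mulr0 /u bn normc0 mulr0.
  by rewrite divfK.
have a'a k : 0 <= normc (a' k) <= a k.
  rewrite normc_ge0 /= /a' normcM normcV normc_real ger0_norm// /u.
  have [bn|bn] := eqVneq (normc (b k)) 0; first by rewrite bn mulr0 mul0r.
  by rewrite mulfK.
have ces_a' : ces p a'.
  apply/(ces_boundedP hp); exists A => n; apply: le_trans (aA n).
  exact: ler_psum_ces.
have [f] := mult a' ces_a'; rewrite a'b => cf [_ fmul].
have [G cG] : exists G, dirichlet_sum_on (half_plane q^-1) (fun k => (g k)%:C)
  G.
  apply: dirichlet_sum_exists => sigma qs.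
  have [W hW] := ces_abs_summable hp hpq g0 gB qs.
  exists W => n; apply: le_trans (hW n); apply: ler_psum => k _.
  by rewrite normc_real ger0_norm.
have normg : (fun k => normc (g k)%:C) = g.
  by apply/funext => k; rewrite normc_real ger0_norm.
have [|h /(ces_boundedP hp)[C hC] ch] := fmul G.
  exists (fun k => (g k)%:C); last exact: cG.
  apply/(ces_boundedP hp).
  by exists B; rewrite normg.
have real_half_plane (sigma : R) : q^-1 < sigma -> half_plane q^-1 sigma%:C by
  [].
have u_summable sigma : q^-1 < sigma ->
    exists W : R, forall n, psum (fun k => u k * k%:R `^ (- sigma)) n <= W.
  by move=> qs; apply: (nonneg_summable u0); exact: cf (real_half_plane _ qs).
pose w n := dconv u g n.
have w0 k : 0 <= w k by exact: dconv_ge0.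
have wE n : dconv (fun k => (u k)%:C) (fun k => (g k)%:C) n = (w n)%:C.
  rewrite /w /dconv rmorph_sum; apply: eq_bigr => k _.
  exact: esym (rmorphM _ _ _).
have cw sigma : q^-1 < sigma ->
    (dirichlet_partial_sum (fun n => (w n)%:C) sigma%:C : nat -> R[i]^o) @ \oo
      --> (f sigma%:C * G sigma%:C : R[i]^o).
  move=> qs; have hs := real_half_plane _ qs.
  have [W hW] := u_summable _ qs.
  have hW' n : psum (fun k => normc (u k)%:C * k%:R `^ (- complex.Re sigma%:C))
    n <= W.
    apply: le_trans (hW n); apply: ler_psum => k _.
    by rewrite normc_real ger0_norm.
  have := dirichlet_mul hW' (cf _ hs) (cG _ hs).
  by rewrite (funext wE).
(* Any abscissa beyond [1/q] would do: all the series converge absolutely there. *)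
pose sigma0 : R := q^-1 + 1.
have qs0 : q^-1 < sigma0 by rewrite ltrDl.
have [U hU] := u_summable _ qs0.
have [V hV] := ces_abs_summable hp hpq g0 gB qs0.
have [H hH] := ces_abs_summable hp hpq (fun k => normc_ge0 (h k)) hC qs0.
have hw n : (0 < n)%N -> h n = (w n)%:C.
  move=> n0; apply/eqP; rewrite -subr_eq0; apply/eqP; move: n n0.
  apply: (@dirichlet_coef_unique R (fun n => h n - (w n)%:C) sigma0 (H + U *
    V)).
    move=> n; apply: le_trans (lerD (hH n) (dconv_summable u0 g0 hU hV n)).
    rewrite -psumD; apply: ler_psum => k _; rewrite -mulrDl ler_wpM2r
      ?powR_ge0//.
    by rewrite (le_trans (le_normcD _ _))// normcN normc_real ger0_norm.
  move=> sigma s0; have qs : q^-1 < sigma := lt_le_trans qs0 s0.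
  have := cvgCD (ch _ (real_half_plane _ qs)) (cvgC_mulr (c := - 1) (cw _ qs)).
  rewrite mulrN1 subrr.
  have -> // : (fun n => dirichlet_partial_sum h sigma%:C n +
      dirichlet_partial_sum (fun n => (w n)%:C) sigma%:C n * (- 1)) =
    dirichlet_partial_sum (fun n => h n - (w n)%:C) sigma%:C.
  apply/funext => n; rewrite mulrN1 /dirichlet_partial_sum -sumrB.
  by apply: eq_bigr => k _; rewrite mulrBl.
exists C => n; apply: le_trans (hC n); rewrite le_eqVlt; apply/orP; left;
  apply/eqP.
apply: eq_psum => k _; congr (_ `^ p); congr (_ * _).
by apply: eq_psum => j /andP[j0 _]; rewrite hw// normc_real ger0_norm.
Qed.

Lemma multiplier_necessary b :
  (forall a, ces p a -> dirichlet_multiplier p q (fun n => a n * b n)) ->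
  d_space q (fun n => b n * (n%:R `^ (- q^-1))%:C).
Proof.
move=> /multiplier_conv_bounded conv.
have [D hD] := selection_bounded hp hpq (fun k => normc_ge0 (b k)) conv.
apply/(d_space_weighted hp hpq).
apply: (@sup_series_selection R (fun k => normc (b k) `^ q / k%:R) D).
  by move=> k; rewrite divr_ge0 ?powR_ge0.
move=> kappa M hk; apply: le_trans (hD kappa M hk); apply: ler_psum => n _.
by rewrite (weighted_powR hp hpq)// normc_ge0.
Qed.

End Multipliers.

Theorem theorem5p2 (R : realType) (p q : R) (b : nat -> R[i])
    (hp : 1 < p) (hpq : p^-1 + q^-1 = 1) :
  ((forall a : nat -> R[i], ces p a ->
      dirichlet_multiplier p q (fun n => a n * b n)) <->
    d_space q (fun n => b n * (n%:R `^ (- q^-1))%:C)) /\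
  (d_space q (fun n => b n * (n%:R `^ (- q^-1))%:C) <->
    (\sum_(1 <= n <oo)
       ereal_sup [set (normc (b k) `^ q / k%:R)%:E
                 | k in [set k | (n <= k)%N]] < +oo)%E).
Proof.
split; last exact: d_space_weighted hp hpq b.
split; first exact: multiplier_necessary hp hpq b.
by move=> hb a; exact: multiplier_sufficient hp hpq b hb a.
Qed.
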